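(* There exists a one-dimensional CA $\mathcal{A}$ such that its persistent language $L_\mu(\mathcal{A})$, with $\mu$ the uniform Bernoulli measure on its alphabet, is not a recursive (decidable) set of words.
   Context: A one-dimensional cellular automaton (CA) $\mathcal{A}$ is given by a finite alphabet $Q$, a radius $r\ge 0$ and a local rule $\delta:Q^{2r+1}\to Q$; it acts on $c\in Q^{\mathbb{Z}}$ by $\mathcal{A}(c)_i=\delta(c_{i-r},\dots,c_{i+r})$. For $u\in Q^*$, $i\in\mathbb{Z}$, $[u]_i=\{c\in Q^{\mathbb{Z}}: c_i\cdots c_{i+|u|-1}=u\}$. The uniform Bernoulli measure $\mu$ satisfies $\mu([u]_i)=|Q|^{-|u|}$; $\mathcal{A}^n\mu(U)=\mu(\mathcal{A}^{-n}(U))$. A word $u$ is persistent for $(\mathcal{A},\mu)$ if $\mathcal{A}^n\mu([u]_0)$ does not tend to $0$ as $n\to\infty$; $L_\mu(\mathcal{A})$ is the set of persistent words. *)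

(* Defs.v *)
From Stdlib Require List.
From mathcomp Require Import all_boot all_order all_algebra.
From mathcomp Require Import boolp.
Set Implicit Arguments. Unset Strict Implicit. Unset Printing Implicit Defensive.
Import Order.TTheory GRing.Theory Num.Theory.

(* A standard model of computation: partial mu-recursive functions     *)
(* (untyped arity: arguments are a list of naturals; a missing        *)
(* argument reads as 0).                                              *)
Inductive recf : Type :=
| rZero : recf
| rSucc : recf
| rProj : nat -> recf
| rComp : recf -> list recf -> recf
| rPrec : recf -> recf -> recf
| rMu   : recf -> recf.

Inductive reval : recf -> seq nat -> nat -> Prop :=
| ev_zero v : reval rZero v 0
| ev_succ v : reval rSucc v (nth 0 v 0).+1
| ev_proj i v : reval (rProj i) v (nth 0 v i)
| ev_comp f gs v ys y :
    List.Forall2 (fun g z => reval g v z) gs ys ->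
    reval f ys y -> reval (rComp f gs) v y
| ev_prec0 f g v y : reval f v y -> reval (rPrec f g) (0 :: v) y
| ev_precS f g n v z y :
    reval (rPrec f g) (n :: v) z -> reval g (n :: z :: v) y ->
    reval (rPrec f g) (n.+1 :: v) y
| ev_mu f v n :
    reval f (n :: v) 0 ->
    (forall m, m < n -> exists k, reval f (m :: v) k.+1) ->
    reval (rMu f) v n.

Definition recursive_nat (P : nat -> Prop) : Prop :=
  exists f : recf, forall n,
    (P n /\ reval f [:: n] 1) \/ (~ P n /\ reval f [:: n] 0).

Definition code_word (Q : finType) (w : seq Q) : nat :=
  CodeSeq.code [seq nat_of_ord (enum_rank q) | q <- w].

Definition recursive_lang (Q : finType) (L : seq Q -> Prop) : Prop :=
  exists f : recf, forall w : seq Q,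
    (L w /\ reval f [:: code_word w] 1) \/ (~ L w /\ reval f [:: code_word w] 0).

Definition config (Q : finType) := int -> Q.

Definition ca_global (Q : finType) (r : nat)
    (delta : {ffun 'I_(2 * r + 1) -> Q} -> Q) (c : config Q) : config Q :=
  fun i => delta [ffun j : 'I_(2 * r + 1) => c (i - r%:Z + (nat_of_ord j)%:Z)%R].

Definition cylinder (Q : finType) (u : seq Q) (i : int) : config Q -> Prop :=
  fun c => [seq c (i + k%:Z)%R | k <- iota 0 (size u)] = u.

(* Uniform Bernoulli measure of a set U of configurations that depends   *)
(* only on the cells a, ..., a+m-1: it is the proportion of the words w *)
(* of length m whose cylinder [w]_a is contained in U (U is then the     *)
(* disjoint union of these cylinders, each of measure |Q|^-m).          *)
Definition unif_measure_win (Q : finType) (U : config Q -> Prop)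
    (a : int) (m : nat) : rat :=
  (#|[set w : m.-tuple Q |
        `[< forall c : config Q, cylinder (tval w) a c -> U c >]]|%:R
   / (#|Q| ^ m)%:R)%R.

(* A^n mu([u]_0) = mu(A^{-n}([u]_0)); A^{-n}([u]_0) depends only on the *)
(* cells -n r, ..., |u|-1+n r.                                          *)
Definition pushforward_cyl (Q : finType) (r : nat)
    (delta : {ffun 'I_(2 * r + 1) -> Q} -> Q) (n : nat) (u : seq Q) : rat :=
  unif_measure_win (fun c => cylinder u 0 (iter n (ca_global delta) c))
    (- (n * r)%:Z)%R (size u + 2 * (n * r)).

Definition tends_to_0 (x : nat -> rat) : Prop :=
  forall eps : rat, (0 < eps)%R -> exists N, forall n, N <= n -> (`|x n| < eps)%R.

Definition persistent (Q : finType) (r : nat)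
    (delta : {ffun 'I_(2 * r + 1) -> Q} -> Q) (u : seq Q) : Prop :=
  ~ tends_to_0 (fun n => pushforward_cyl delta n u).

(* Main.v *)
Require Import Defs.
From HB Require Import structures.
From mathcomp Require Import all_boot all_order all_algebra.
From mathcomp Require Import boolp zify.

(* Walls are permanent, so between two walls the automaton is a finite deterministic system that
   simulates a one-head machine; any local inconsistency, in particular a second head, and any
   attempt of the head to leave the segment creates an error state that invades the segment.
   Let [u] be a wall followed by an initial machine state, the part of the segment to the right
   of [u] being free. If the machine returns to this initial state, then [u] recurs
   periodically in a large enough segment, and a fixed such segment has positive probability.
   If its head falls off, then in every segment [u] is eventually replaced by the error state,
   and since long segments have small probability the probability of [u] tends to 0.
   The machine interprets programs coded by integers; on input [n] it runs the program [n] on [n]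
   and returns to its initial state when the result is 0. A recursive function [f] deciding
   persistence is compiled to a program [n] that maps [n] to the value of [f] at the code of the
   word [u] associated with [n], a contradiction by diagonalization. *)

Set Implicit Arguments. Unset Strict Implicit. Unset Printing Implicit Defensive.

(** * The machine and the cellular automaton *)

Inductive cmd (track : Type) : Type :=
| Skip
| MoveR
| MoveL
| Write of track & bool
| Seq of cmd track & cmd track
| Until of track & cmd track
| If of track & cmd track & cmd track.
Arguments Skip {track}.
Arguments MoveR {track}.
Arguments MoveL {track}.

(** Equality of commands is decided classically, which is enough to form the finite type [ctl] of
    control stacks. *)
HB.instance Definition _ (track : Type) := gen_eqMixin (cmd track).
HB.instance Definition _ (track : Type) := gen_choiceMixin (cmd track).

Section Machine.
Variable track : finType.
Variable main : cmd track.
Implicit Types (c : cmd track) (k : seq (cmd track)).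

Definition symbol := {ffun track -> bool}.
Definition tape := nat -> symbol.

(* The third component is the head move: [Some true] to the right,
   [Some false] to the left. *)
Definition local_step k (s : symbol) : seq (cmd track) * symbol * option bool :=
  if k is c :: k' then
    match c with
    | Skip => (k', s, None)
    | MoveR => (k', s, Some true)
    | MoveL => (k', s, Some false)
    | Write j b => (k', [ffun i => if i == j then b else s i], None)
    | Seq a b => (a :: b :: k', s, None)
    | Until j a => (if s j then k' else a :: c :: k', s, None)
    | If j a b => ((if s j then a else b) :: k', s, None)
    end
  else ([:: main], s, None).

Definition mstate : Type := seq (cmd track) * nat * tape.

(** The tape is unbounded on the right; [None] arises only from a left move at position [0]. *)
Definition mstep (st : mstate) : option mstate :=
  let: (k, p, t) := st in
  let: (k', s, m) := local_step k (t p) in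
  let t' : tape := fun i => if i == p then s else t i in
  match m with
  | None => Some (k', p, t')
  | Some true => Some (k', p.+1, t')
  | Some false => if p is p'.+1 then Some (k', p', t') else None
  end.

Definition miter n (st : mstate) := iter n (obind mstep) (Some st).

Definition reach (st st' : mstate) := exists n, miter n st = Some st'.

Lemma miterD m n st st' :
  miter m st = Some st' -> miter (n + m) st = miter n st'.
Proof. by rewrite /miter iterD => ->. Qed.

Lemma reach_trans st1 st2 st3 : reach st1 st2 -> reach st2 st3 -> reach st1 st3.
Proof. by move=> [m Hm] [n Hn]; exists (n + m); rewrite (miterD _ Hm). Qed.

Lemma overwrite_same (t : tape) p : (fun i => if i == p then t p else t i) = t.
Proof. by apply: funext => i; case: eqP => [->|]. Qed.

(** * Finiteness of the control *)

Fixpoint continuations c k : seq (seq (cmd track)) :=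
  (c :: k) :: match c with
  | Seq a b => continuations a (b :: k) ++ continuations b k
  | Until _ a => continuations a (c :: k)
  | If _ a b => continuations a k ++ continuations b k
  | _ => [::]
  end.

Lemma mem_continuations c k : c :: k \in continuations c k.
Proof. by case: c => *; rewrite /= inE eqxx. Qed.

(** A loop pushes itself back under its own body, so running [c] above [k] meets only stacks of this
    finite list until [k] itself is uncovered. *)
Lemma local_step_continuations c k k' s : k' \in continuations c k ->
  (local_step k' s).1.1 \in k :: continuations c k.
Proof.
elim: c k k' => [||| j b | a IHa b IHb | j a IHa | j a IHa b IHb] k k' /=;
  rewrite in_cons => /predU1P[->|] //=; rewrite ?in_cons ?eqxx ?orbT ?mem_cat //.
- by rewrite mem_continuations !orbT.
- case/orP=> [/(IHa _ _)|/(IHb _ _)]; rewrite inE => /predU1P[->|->].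
  + by rewrite mem_continuations !orbT.
  + by rewrite !orbT.
  + by rewrite eqxx.
  + by rewrite !orbT.
- by case: ifP; rewrite ?eqxx ?mem_continuations ?orbT.
- by move=> /(IHa _ _); rewrite inE => /predU1P[->|->]; rewrite ?eqxx ?orbT.
- by case: ifP; rewrite mem_continuations ?orbT.
- case/orP=> [/(IHa _ _)|/(IHb _ _)]; rewrite inE => /predU1P[->|->];
  by rewrite ?eqxx ?orbT.
Qed.

Definition all_continuations := [::] :: continuations main [::].
Definition ctl := seq_sub all_continuations.
Definition ctl0 : ctl := SeqSub (mem_head [::] (continuations main [::])).
Definition to_ctl k : ctl := insubd ctl0 k.

Lemma to_ctlK k : k \in all_continuations -> val (to_ctl k) = k.
Proof. exact: insubdK. Qed.

Lemma mem_main : [:: main] \in all_continuations.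
Proof. by rewrite inE mem_continuations orbT. Qed.

Lemma local_step_mem k s :
  k \in all_continuations -> (local_step k s).1.1 \in all_continuations.
Proof.
rewrite inE => /predU1P[->|]; first exact: mem_main.
exact: local_step_continuations.
Qed.

(* [None] is the wall, [Some None] the error state; in the other cells, [inl true] marks
   a cell lying to the left of the head and [inl false] a cell lying to its right. *)
Definition cell : finType := option (option (symbol * (bool + ctl))).
Definition err : cell := Some None.
Definition mk_cell (s : symbol) (h : bool + ctl) : cell := Some (Some (s, h)).

Definition left_or_wall (q : cell) :=
  match q with None | Some (Some (_, inl true)) => true | _ => false end.
Definition left_or_head (q : cell) :=
  match q with Some (Some (_, inl true)) | Some (Some (_, inr _)) => true | _ => false end.
Definition head_or_right (q : cell) :=
  match q with Some (Some (_, inl false)) | Some (Some (_, inr _)) => true | _ => false end.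
Definition right_or_wall (q : cell) :=
  match q with None | Some (Some (_, inl false)) => true | _ => false end.

(** Between two walls these pairs allow only a run of left cells, one head and a run of right cells,
    so a consistent segment has exactly one head. The error state is compatible with nothing. *)
Definition compatible (q q' : cell) :=
  left_or_wall q && left_or_head q' || head_or_right q && right_or_wall q'.

Definition arriving (d : bool) (q : cell) : option ctl :=
  if q is Some (Some (s, inr k)) then
    let: (k', _, m) := local_step (val k) s in
    if m == Some d then Some (to_ctl k') else None
  else None.

Definition local_rule (a b c : cell) : cell :=
  if b is Some (Some (s, h)) then
    if compatible a b && compatible b c then
      match h with
      | inr k =>
        let: (k', s', m) := local_step (val k) s in
        match m with
        | None => mk_cell s' (inr (to_ctl k'))
        | Some true => if c is None then err else mk_cell s' (inl true)
        | Some false => if a is None then err else mk_cell s' (inl false)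
        end
      | inl true => if arriving false c is Some k' then mk_cell s (inr k') else b
      | inl false => if arriving true a is Some k' then mk_cell s (inr k') else b
      end
    else err
  else b.

(** The automaton on the half-line to the right of a wall: cell [0], where the wall stands, is
    frozen. *)
Definition half_step (g : nat -> cell) (i : nat) : cell :=
  if i is i'.+1 then local_rule (g i') (g i) (g i.+1) else g 0.

Lemma half_step_wall g i : g i = None -> half_step g i = None.
Proof. by case: i => //= i ->. Qed.

Lemma half_step_cell g i : g i != None -> half_step g i != None.
Proof.
case: i => //= i; rewrite /local_rule; case: (g i.+1) => // -[[s h]|] // _.
case: ifP => // _; case: h => [[]|k].
- by case: arriving.
- by case: arriving.
by case: local_step => -[k' s'] [[]|] //; [case: (g i.+2) | case: (g i)].
Qed.

Lemma iter_half_step_wall n g i : g i = None -> iter n half_step g i = None.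
Proof. by move=> gi; elim: n => //= n; apply: half_step_wall. Qed.

Lemma iter_half_step_cell n g i : g i != None -> iter n half_step g i != None.
Proof. by move=> gi; elim: n => //= n; apply: half_step_cell. Qed.

Lemma half_step_err g i : g i = err -> half_step g i = err.
Proof. by case: i => //= i ->. Qed.

Lemma iter_half_step_err n g i : g i = err -> iter n half_step g i = err.
Proof. by move=> gi; elim: n => //= n; apply: half_step_err. Qed.

Lemma half_step_incompatible g i : g i.+1 != None ->
  ~~ (compatible (g i) (g i.+1) && compatible (g i.+1) (g i.+2)) ->
  half_step g i.+1 = err.
Proof. by rewrite /= /local_rule; case: (g i.+1) => [[[s h]|]|] // _ /negbTE->. Qed.

Lemma half_step_err_left g i :
  g i.+1 != None -> g i.+2 = err -> half_step g i.+1 = err.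
Proof.
move=> gi gE; apply: half_step_incompatible => //.
by rewrite gE /compatible /= !andbF.
Qed.

(** An error is incompatible with its left neighbour, so it advances to the left by one cell per
    step until it meets a wall. *)
Lemma err_spreads g i : (forall j, j <= i -> g j.+1 != None) -> g i.+1 = err ->
  forall t, i <= t -> iter t half_step g 1 = err.
Proof.
elim: i g => [|i IHi] g nw gE t; first by move=> _; apply: iter_half_step_err.
case: t => // t lit; rewrite iterSr IHi //.
- by move=> j lej; apply: half_step_cell; apply: nw; apply: leq_trans lej _.
- by apply: half_step_err_left; rewrite // nw.
Qed.

Definition head_mark k (p i : nat) : bool + ctl :=
  if i < p then inl true else if i == p then inr (to_ctl k) else inl false.

Definition segment (g : nat -> cell) (N : nat) (st : mstate) :=
  let: (k, p, t) := st in
  [/\ g 0 = None, g N.+1 = None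
    & forall i, i < N -> g i.+1 = mk_cell (t i) (head_mark k p i)].

Section SegmentStep.
Variables (g : nat -> cell) (N : nat) (k : seq (cmd track)) (p : nat) (t : tape).
Hypotheses (gS : segment g N (k, p, t)) (ltpN : p < N) (kL : k \in all_continuations).

Let segment_left_or_wall i : i <= p -> left_or_wall (g i).
Proof.
case: gS => g0 _ gi; case: i => [|i] lip; first by rewrite g0.
by rewrite gi ?(ltn_trans lip) // /head_mark lip.
Qed.

Let segment_left_or_head i : i <= p -> left_or_head (g i.+1).
Proof.
case: gS => g0 _ gi lip; rewrite gi ?(leq_ltn_trans lip) // /head_mark.
by case: ltngtP lip.
Qed.

Let segment_head_or_right i : p <= i -> i < N -> head_or_right (g i.+1).
Proof. by case: gS => g0 _ gi lip liN; rewrite gi // /head_mark; case: ltngtP lip. Qed.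

Let segment_right_or_wall i : p < i -> i <= N -> right_or_wall (g i.+1).
Proof.
case: gS => g0 gN gi lip; rewrite leq_eqVlt => /predU1P[->|liN]; first by rewrite gN.
by rewrite gi // /head_mark; case: ltngtP lip.
Qed.

Let segment_compatible i : i <= N -> compatible (g i) (g i.+1).
Proof.
rewrite /compatible => leiN; case: (leqP i p) => [lip|].
  by rewrite segment_left_or_wall // segment_left_or_head.
case: i leiN => // i liN lpi.
by rewrite segment_head_or_right // segment_right_or_wall ?orbT.
Qed.

(** The hypothesis covers both exits: no successor at the left wall, and a successor beyond the last
    position at the right wall. *)
Lemma half_step_segment_fail :
  (forall st, mstep (k, p, t) = Some st -> N <= st.1.2) -> half_step g p.+1 = err.
Proof.
move=> bad; rewrite /= /local_rule.
have [c1 c2] := (segment_compatible (ltnW ltpN), segment_compatible ltpN).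
have gp1 : g p.+1 = mk_cell (t p) (inr (to_ctl k)).
  by case: gS => _ _ ->; rewrite // /head_mark ltnn eqxx.
rewrite c1 c2 gp1 /= to_ctlK //; move: bad; rewrite /mstep.
case: local_step => -[k' s'] [[]|] /=; last first.
- by move=> /(_ _ erefl) /=; rewrite leqNgt ltpN.
- case: gS => g0 _ gi; case: (posnP p) => [-> _|]; first by rewrite g0.
  by case: (p) ltpN => // p' /ltnW lpN _ /(_ _ erefl) /=; rewrite leqNgt lpN.
- move=> /(_ _ erefl) /= leN; case: gS => _ gN _.
  by have <- : N = p.+1; [apply/eqP; rewrite eqn_leq leN | rewrite gN].
Qed.

(** A move is shared by two cells: the old head cell becomes an ordinary one, and the cell moved to
    finds the new control through [arriving]. The proof treats the cells left of, right of and at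
    the head. *)
Lemma half_step_segment st :
  mstep (k, p, t) = Some st -> st.1.2 < N -> segment (half_step g) N st.
Proof.
case: st => -[k' p'] t' /=; case E: local_step => [[k1 s1] m] Em lt'.
have k1L : k1 \in all_continuations by have := local_step_mem (t p) kL; rewrite E.
have [g0 gN gi] := gS.
have arr d j : j < N -> arriving d (g j.+1) =
    if (j == p) && (m == Some d) then Some (to_ctl k1) else None.
  move=> ljN; rewrite gi // /head_mark; case: ltngtP => //= ->.
  by rewrite to_ctlK // E.
split; [exact: g0 | by rewrite /local_rule gN |].
move=> i liN; rewrite /= /local_rule !segment_compatible //; last exact: ltnW.
rewrite gi //=; case: (ltngtP i p) => [lip|lpi|eip].
- have -> : head_mark k p i = inl true by rewrite /head_mark lip.
  rewrite arr ?(leq_ltn_trans lip) //.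
  case: m E Em {arr} => [[]|] E Em; rewrite ?andbF ?andbT.
  + case: Em => _ <- <-; rewrite (ltn_eqF lip) /head_mark.
    by rewrite ltnS (ltnW lip).
  + case: (p) lip Em => // p1 lip [<- <- <-]; rewrite (ltn_eqF lip) eqSS /head_mark.
    by case: (ltngtP i p1) lip => // h; rewrite ltnS leqNgt h.
  + by case: Em => _ <- <-; rewrite (ltn_eqF lip) /head_mark lip ?if_same.
- have -> : head_mark k p i = inl false by rewrite /head_mark; case: ltngtP lpi.
  case: i liN lpi => // i liN lpi; rewrite arr ?(ltnW liN) //.
  case: m E Em {arr} => [[]|] E Em; rewrite ?andbF ?andbT.
  + case: Em => <- <- <-; rewrite (gtn_eqF lpi) /head_mark eqSS ltnS.
    by case: (ltngtP i p) lpi => // h; rewrite ltnS leqNgt h.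
  + case: (p) lpi Em => // p1 lpi [<- <- <-]; rewrite (gtn_eqF lpi) /head_mark ?if_same.
    by case: (ltngtP i.+1 p1) (ltnW lpi).
  + by case: Em => _ <- <-; rewrite (gtn_eqF lpi) /head_mark ?if_same; case: ltngtP lpi.
- have -> : head_mark k p i = inr (to_ctl k) by rewrite /head_mark eip ltnn eqxx.
  rewrite to_ctlK // eip E; case: m E Em lt' {arr} => [[]|] E Em lt'.
  + case: Em lt' => <- <- <- lt'; rewrite eqxx /head_mark ltnS leqnn.
    by rewrite gi.
  + case: (p) ltpN Em gi => // p1 ltN [<- <- <-] gi'; rewrite eqxx gi' ?(ltnW ltN) //.
    by rewrite /head_mark; case: ltngtP (ltnSn p1).
  + by case: Em => <- <- <-; rewrite eqxx /head_mark ltnn eqxx.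
Qed.
End SegmentStep.

Lemma miter_pos n st st' : miter n st = Some st' -> st'.1.2 <= st.1.2 + n.
Proof.
rewrite /miter; elim: n st' => [|n IHn] st' /=; first by case=> <-; rewrite addn0.
case: (iter n _ _) IHn => //= -[[k p] t] /(_ _ erefl) /= IHn.
rewrite addnS; case: local_step => -[k' s] [[]|] /=.
- by case=> <-.
- by case: p IHn => // p IHn [<-] /=; rewrite (leq_trans _ (leqW IHn)) ?leqnSn.
- by case=> <- /=; apply: leqW.
Qed.

Lemma mstep_mem st st' : st.1.1 \in all_continuations -> mstep st = Some st' ->
  st'.1.1 \in all_continuations.
Proof.
case: st => -[k p] t /= /(local_step_mem (t p)).
case: local_step => -[k' s] [[]|] /= k'L; first by case=> <-.
  by case: p => // p [<-].
by case=> <-.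
Qed.

(** The head moves by at most one position per step, so [st.1.2 + n < N] keeps it off the right wall
    during the whole run. *)
Lemma segment_run n g N st st' : segment g N st -> st.1.1 \in all_continuations ->
  st.1.2 + n < N -> miter n st = Some st' -> segment (iter n half_step g) N st'.
Proof.
elim: n g st => [|n IHn] g st gS kL ltN; first by case=> <-.
rewrite /miter !iterSr /=; case E: (mstep st) => [st1|] //=; last first.
  by rewrite (_ : iter n _ None = None) //; elim: (n) => //= m ->.
have p1 : st1.1.2 <= st.1.2 + 1 by apply: (@miter_pos 1).
have lt1 : st1.1.2 + n < N by apply: leq_ltn_trans ltN; rewrite -add1n addnA leq_add2r.
case: st gS kL ltN E p1 => -[k p] t gS kL ltN E p1.
apply: IHn => //; last by apply: mstep_mem E.
apply: half_step_segment gS _ _ _ E _ => //.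
  by apply: leq_ltn_trans ltN; rewrite leq_addr.
by apply: leq_ltn_trans lt1; rewrite leq_addr.
Qed.

(** In a segment too short for the run, the head meets the right wall before it can fall off on the
    left; this creates an error as well. *)
Lemma segment_fail n g N st : segment g N st -> st.1.1 \in all_continuations ->
  st.1.2 < N -> miter n st = None ->
  exists t i, i < N /\ iter t half_step g i.+1 = err.
Proof.
elim: n g st => [|n IHn] g st gS kL ltN //.
rewrite /miter iterSr -/(iter _ _ _) /= => E.
case: st gS kL ltN E => -[k p] t gS kL ltN E.
have [[st1 E1 lt1]|bad] := pselect (exists2 st1, mstep (k, p, t) = Some st1 & st1.1.2 < N).
  rewrite E1 in E; have [|||t0 [i [liN Ei]]] := IHn (half_step g) st1 _ _ _ E => //.
  - exact: half_step_segment gS _ _ _ E1 _.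
  - exact: mstep_mem E1.
  - by exists t0.+1, i; rewrite iterSr.
exists 1, p; split=> //=; apply: half_step_segment_fail gS _ _ _ => // st1 E1.
by rewrite leqNgt; apply/negP => lt1; apply: bad; exists st1.
Qed.

Lemma segment_fail_err n g N st : segment g N st -> st.1.1 \in all_continuations ->
  st.1.2 < N -> miter n st = None ->
  exists t0, forall t, t0 <= t -> iter t half_step g 1 = err.
Proof.
move=> gS kL ltN /(segment_fail gS kL ltN)[t1 [i [liN Ei]]].
exists (i + t1) => t /subnK <-; rewrite addnA iterD.
apply: err_spreads Ei _ _; last exact: leq_addl.
case: st gS {kL ltN} => -[k p] s [_ _ gi] j leji.
by apply: iter_half_step_cell; rewrite gi // (leq_ltn_trans leji).
Qed.

(** * Segments beginning with the initial word *)

Definition right_cell (q : cell) := if q is Some (Some (_, inl false)) then true else false.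

Definition init_word (l : nat) (t : tape) : seq cell :=
  None :: [seq mk_cell (t i) (head_mark [:: main] 0 i) | i <- iota 0 l].

(** Either all later cells are right cells, and the segment is a machine state that fails, or the
    first other cell is incompatible with its left neighbour. Both cases produce an error, which
    spreads to cell [1]. *)
Lemma init_prefix_err g N l t :
  1 < l -> [seq g i | i <- iota 0 l.+1] = init_word l t ->
  g N.+1 = None -> (forall i, i < N -> g i.+1 != None) ->
  (forall t' : tape, (forall i, i < l -> t' i = t i) ->
     exists n, miter n ([:: main], 0, t') = None) ->
  exists t0, forall s, t0 <= s -> iter s half_step g 1 = err.
Proof.
move=> l1 gw gN nw fail.
have gE i : i < l.+1 -> g i = nth None (init_word l t) i.
  by move=> li; rewrite -gw (nth_map 0) ?size_iota // nth_iota.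
have g0 : g 0 = None by rewrite gE.
have gl i : i < l -> g i.+1 = mk_cell (t i) (head_mark [:: main] 0 i).
  by move=> li; rewrite gE //= (nth_map 0) ?size_iota // nth_iota.
have lN : l <= N.
  by rewrite leqNgt; apply/negP => Nl; move: gN; rewrite gl.
have [allR|] := boolP [forall i : 'I_N, (0 < i) ==> right_cell (g i.+1)].
  (* The tape is read off the segment; it agrees with [t] on the prefix, so [fail] applies to it. *)
  pose t' : tape := fun i => if g i.+1 is Some (Some (s, _)) then s else t i.
  have [|n] := fail t'; first by move=> i li; rewrite /t' gl.
  apply: (@segment_fail_err _ _ N); rewrite ?mem_main //=; last first.
    by apply: leq_trans lN; apply: ltnW.
  split=> // i liN; rewrite /t'; case: (posnP i) => [->|i0].
    by rewrite gl // ltnW.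
  have := forallP allR (Ordinal liN); rewrite i0 /= /head_mark.
  by case: (g i.+1) => [[[s [[]|]]|]|] // _; case: i i0 {liN}.
case/forallPn=> -[i0 li0] /=; rewrite negb_imply => bad0.
have ex : exists i, [&& i < N, 0 < i & ~~ right_cell (g i.+1)] by exists i0; rewrite li0.
have [i /and3P[liN i_gt0 badi] imin] := ex_minnP ex.
have li : l <= i.
  rewrite leqNgt; apply/negP => li; move: badi; rewrite gl //.
  by case: (i) i_gt0.
case: i liN i_gt0 badi imin li => // i liN _ badi imin li.
(* By [1 < l] the cell before the first bad one is not the head cell, so it is a right cell by
   minimality. *)
have goodi : right_cell (g i.+1).
  have i_gt0 : 0 < i by rewrite -ltnS (leq_trans l1 li).
  by apply/negPn/negP => bad; have := imin i; rewrite bad (ltnW liN) i_gt0 ltnn => /(_ isT).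
have Ei : iter 1 half_step g i.+2 = err.
  apply: half_step_incompatible; first exact: nw.
  move: goodi badi (nw _ liN); rewrite /compatible.
  by case: (g i.+1) => [[[s [[]|]]|]|] // _; case: (g i.+2) => [[[s' [[]|]]|]|].
exists (i.+1 + 1) => s /subnK <-; rewrite addnA iterD.
apply: err_spreads Ei _ _; last exact: leq_addl.
by move=> j ji; apply: iter_half_step_cell; apply: nw; apply: leq_ltn_trans liN.
Qed.

Lemma segment_period n g N t :
  segment g N ([:: main], 0, t) -> n < N ->
  miter n ([:: main], 0, t) = Some ([:: main], 0, t) ->
  forall m, segment (iter (m * n) half_step g) N ([:: main], 0, t).
Proof.
move=> gS nN per; elim=> // m IHm; rewrite mulSn iterD.
by apply: segment_run per; rewrite // mem_main.
Qed.

End Machine.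

(** * Counter programs and the interpreter *)

Notation code := CodeSeq.code.

Notation "c1 ;; c2" := (Seq c1 c2) (at level 61, right associativity).

Definition cons_code (x m : nat) := 2 ^ x * m.*2.+1.

Lemma code_cons x v : code (x :: v) = cons_code x (code v).
Proof. by []. Qed.

Lemma cons_code_gt0 x m : 0 < cons_code x m.
Proof. by rewrite muln_gt0 expn_gt0. Qed.

Section Counters.
Variables (R : finType) (main : cmd (option R)) (clean : bool).
Implicit Types (a b : R -> nat) (k : seq (cmd (option R))).
Local Notation reach := (reach main).

Definition overwrite (t : tape (option R)) p j v : tape (option R) :=
  fun i => if i == p then [ffun x => if x == j then v else t p x] else t i.

Lemma overwriteE t p j v i x :
  overwrite t p j v i x = if (i == p) && (x == j) then v else t i x.
Proof.
by rewrite /overwrite; case: eqP => [->|] //=; rewrite ffunE.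
Qed.

Lemma reach_stay c' k p t k' : local_step main (c' :: k) (t p) = (k', t p, None) ->
  reach (c' :: k, p, t) (k', p, t).
Proof.
by move=> E; exists 1; rewrite -[LHS]/(mstep main (c' :: k, p, t)) /mstep E overwrite_same.
Qed.

Lemma reach_right k p t : reach (MoveR :: k, p, t) (k, p.+1, t).
Proof. by exists 1; rewrite /miter /= overwrite_same. Qed.

Lemma reach_left k p t : reach (MoveL :: k, p.+1, t) (k, p, t).
Proof. by exists 1; rewrite /miter /= overwrite_same. Qed.

Lemma reach_write j v k p t : reach (Write j v :: k, p, t) (k, p, overwrite t p j v).
Proof. by exists 1. Qed.

Lemma reach_seq c1 c2 k p t st :
  reach (c1 :: c2 :: k, p, t) st -> reach (Seq c1 c2 :: k, p, t) st.
Proof. by apply: reach_trans; apply: reach_stay. Qed.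

Lemma reach_until j c1 k p t :
  reach (Until j c1 :: k, p, t) (if t p j then k else c1 :: Until j c1 :: k, p, t).
Proof. by apply: reach_stay => /=; case: ifP. Qed.

Lemma reach_if j c1 c2 k p t :
  reach (If j c1 c2 :: k, p, t) ((if t p j then c1 else c2) :: k, p, t).
Proof. exact: reach_stay. Qed.

Lemma reach_seek j k (t : tape (option R)) p q :
  (forall i, i < p -> t i j = false) -> t p j -> q <= p ->
  reach (Until j MoveR :: k, q, t) (k, p, t).
Proof.
move=> tlt tp /subnKC; move: (p - q) => d; elim: d q => [|d IHd] q0.
  by rewrite addn0 => ->; have := reach_until j MoveR k p t; rewrite tp.
move=> eqp; have := reach_until j MoveR k q0 t; rewrite tlt; last by rewrite -eqp; lia.
move/reach_trans; apply; apply: reach_trans (reach_right _ _ _) _.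
by apply: IHd; rewrite addSnnS.
Qed.

Lemma reach_home j k (t : tape (option R)) p : (forall i, 0 < i <= p -> t i j = false) -> t 0 j ->
  reach (Until j MoveL :: k, p, t) (k, 0, t).
Proof.
move=> tlt t0; elim: p tlt => [|p IHp] tlt.
  by have := reach_until j MoveL k 0 t; rewrite t0.
have := reach_until j MoveL k p.+1 t; rewrite tlt ?leqnn //.
move/reach_trans; apply; apply: reach_trans (reach_left _ _ _) _.
by apply: IHp => i /andP[i0 ip]; rewrite tlt // i0 leqW.
Qed.

(* Counter [r] has the value [p] when the leftmost mark of its track is at [p]; the home track
   [None] marks position 0. Unless [clean] holds, the tape may carry arbitrary garbage to the
   right of the marks. *)
Definition represents (t : tape (option R)) a := forall r p, clean || (p <= a r) ->
  t p (Some r) = (p == a r) /\ t p None = (p == 0).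

(** The head starts and ends at home and the pending stack [k] is arbitrary, so that runs
    compose. *)
Definition runs c' a b := forall t k, represents t a ->
  exists2 t', represents t' b & reach (c' :: k, 0, t) (k, 0, t').

Definition upd a r v : R -> nat := fun x => if x == r then v else a x.

(** The cell that receives the mark may hold garbage, including a stray home mark;
    [Write None false] erases it so that the way back stops only at position [0]. *)
Definition inc r : cmd (option R) :=
  Seq (Until (Some r) MoveR) (Seq (Write (Some r) false) (Seq MoveR
    (Seq (Write None false) (Seq (Write (Some r) true) (Until None MoveL))))).

Definition dec r : cmd (option R) :=
  If (Some r) Skip
    (Seq (Until (Some r) MoveR) (Seq (Write (Some r) false) (Seq MoveL
      (Seq (Write (Some r) true) (Until None MoveL))))).

Lemma runs_eq c' a b b' : runs c' a b -> b =1 b' -> runs c' a b'.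
Proof. by move=> H /funext<-. Qed.

Lemma runs_eql c' a a' b : a =1 a' -> runs c' a b -> runs c' a' b.
Proof. by move=> /funext<-. Qed.

Lemma runs_skip a : runs Skip a a.
Proof. by move=> t k ta; exists t => //; apply: reach_stay. Qed.

Lemma runs_seq c1 c2 a b b' : runs c1 a b -> runs c2 b b' -> runs (Seq c1 c2) a b'.
Proof.
move=> H1 H2 t k /(H1 t (c2 :: k))[t1 /(H2 t1 k)[t2 t2c R2] R1].
by exists t2 => //; apply: reach_seq; apply: reach_trans R2.
Qed.

Lemma represents_zero t a r : represents t a -> t 0 (Some r) = (a r == 0).
Proof. by move=> /(_ r 0); rewrite leq0n orbT eq_sym => /(_ isT)[]. Qed.

Lemma runs_until0 r c1 a : a r = 0 -> runs (Until (Some r) c1) a a.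
Proof.
move=> r0 t k ta; exists t => //; have := reach_until (Some r) c1 k 0 t.
by rewrite (represents_zero _ ta) r0.
Qed.

Lemma runs_untilS r c1 a b b' : 0 < a r -> runs c1 a b ->
  runs (Until (Some r) c1) b b' -> runs (Until (Some r) c1) a b'.
Proof.
move=> r0 H1 H2 t k ta; have [t1 /(H2 t1 k)[t2 t2c R2] R1] := H1 t (Until (Some r) c1 :: k) ta.
exists t2 => //; have := reach_until (Some r) c1 k 0 t.
rewrite (represents_zero _ ta) eqn0Ngt r0 => /reach_trans; apply.
exact: reach_trans R2.
Qed.

Lemma runs_if r c1 c2 a b :
  runs (if a r == 0 then c1 else c2) a b -> runs (If (Some r) c1 c2) a b.
Proof.
move=> H t k ta; have [t1 t1b R1] := H t k ta; exists t1 => //.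
by apply: reach_trans R1; rewrite -(represents_zero _ ta); apply: reach_if.
Qed.

Lemma runs_inc r a : runs (inc r) a (upd a r (a r).+1).
Proof.
move=> t k ta; pose p := a r.
pose t' := overwrite (overwrite (overwrite t p (Some r) false) p.+1 None false)
  p.+1 (Some r) true.
have t't i x : t' i x = if i == p.+1 then
    if x == Some r then true else if x == None then false else t i x
  else if (i == p) && (x == Some r) then false else t i x.
  rewrite /t' !overwriteE; case: (i =P p.+1) => //= ->.
  by rewrite gtn_eqF ?ltnSn.
have t'a : represents t' (upd a r (a r).+1).
  move=> r0 i Hi; rewrite !t't -/p.
  have old : clean || (i <= p) -> t i (Some r) = (i == p) /\ t i None = (i == 0).
    exact: ta.
  have old0 : clean || (i <= a r0) -> t i (Some r0) = (i == a r0) /\ t i None = (i == 0).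
    exact: ta.
  move: Hi; rewrite /upd (inj_eq (@Some_inj _)) -/p.
  case: (r0 =P r) => [->|nr] Hi; rewrite ?andbT ?andbF.
    case: (i =P p.+1) => [->|nip] //.
    have /old[-> ->] : clean || (i <= p).
      case/orP: Hi => [->//|]; rewrite leq_eqVlt => /predU1P[//|].
      by rewrite ltnS => ->; rewrite orbT.
    by split; [case: eqP | rewrite /= ?andbF].
  have [-> ->] := old0 Hi.
  by case: (i =P p.+1) => [->|nip]; rewrite /= ?andbF.
exists t' => //.
have pr q : q <= p -> t q (Some r) = (q == p).
  by move=> le; case: (ta r q); rewrite // le orbT.
have ph q : q <= p -> t q None = (q == 0).
  by move=> le; case: (ta r q); rewrite // le orbT.
apply: reach_seq; apply: reach_trans (reach_seek _ _ _ (leq0n p)) _.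
- by move=> i lip; rewrite pr ?(ltnW lip) // ltn_eqF.
- by rewrite pr ?eqxx.
apply: reach_seq; apply: reach_trans (reach_write _ _ _ _ _) _.
apply: reach_seq; apply: reach_trans (reach_right _ _ _) _.
apply: reach_seq; apply: reach_trans (reach_write _ _ _ _ _) _.
apply: reach_seq; apply: reach_trans (reach_write _ _ _ _ _) _.
apply: reach_home => [i /andP[i0 ip]|]; rewrite -/t' t't /=.
  case: (i =P p.+1) => // /eqP nip; rewrite andbF ph; first by rewrite gtn_eqF.
  by rewrite -ltnS ltn_neqAle nip.
by rewrite andbF ph.
Qed.

Lemma runs_dec r a : runs (dec r) a (upd a r (a r).-1).
Proof.
apply: runs_if; case: (posnP (a r)) => r0 /=.
  apply: runs_eq (@runs_skip a) _ => x; rewrite /upd r0.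
  by case: eqP => // ->.
move=> t k ta; pose p := (a r).-1.
have ar : a r = p.+1 by rewrite prednK.
pose t' := overwrite (overwrite t p.+1 (Some r) false) p (Some r) true.
have t't i x : t' i x = if x == Some r then
    if i == p then true else if i == p.+1 then false else t i x
  else t i x.
  by rewrite /t' !overwriteE; case: (x == Some r); rewrite ?andbT ?andbF.
have t'a : represents t' (upd a r p).
  move=> x i Hi; rewrite !t't.
  have old : clean || (i <= p.+1) -> t i (Some r) = (i == p.+1) /\ t i None = (i == 0).
    by rewrite -ar; apply: ta.
  have old0 : clean || (i <= a x) -> t i (Some x) = (i == a x) /\ t i None = (i == 0).
    exact: ta.
  move: Hi; rewrite /upd (inj_eq (@Some_inj _)).
  case: (x =P r) => [->|nr] Hi /=; last exact: old0.
  have [|-> ->] := old; first by case/orP: Hi => [->//|/leqW ->]; rewrite orbT.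
  by do 2!case: eqP.
exists t' => //.
have pr q : q <= p.+1 -> t q (Some r) = (q == p.+1).
  by move=> le; rewrite -ar; case: (ta r q); rewrite // ar le orbT.
have ph q : q <= p.+1 -> t q None = (q == 0).
  by move=> le; case: (ta r q); rewrite // ar le orbT.
apply: reach_seq; apply: reach_trans (reach_seek _ _ _ (leq0n p.+1)) _.
- by move=> i lip; rewrite pr ?(ltnW lip) // ltn_eqF.
- by rewrite pr ?eqxx.
apply: reach_seq; apply: reach_trans (reach_write _ _ _ _ _) _.
apply: reach_seq; apply: reach_trans (reach_left _ _ _) _.
apply: reach_seq; apply: reach_trans (reach_write _ _ _ _ _) _.
apply: reach_home => [i /andP[i0 ip]|]; rewrite -/t' t't /=.
  by rewrite ph ?gtn_eqF // leqW.
by rewrite ph.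
Qed.

Lemma runs_if0 r c1 c2 a b : a r = 0 -> runs c1 a b -> runs (If (Some r) c1 c2) a b.
Proof. by move=> r0 H; apply: runs_if; rewrite r0. Qed.

Lemma runs_ifS r c1 c2 a b : 0 < a r -> runs c2 a b -> runs (If (Some r) c1 c2) a b.
Proof. by move=> r0 H; apply: runs_if; rewrite eqn0Ngt r0. Qed.

(** * Arithmetic and list operations on counters *)

Definition loop r (e : cmd (option R)) := Until (Some r) e.

Definition add r s := loop r (dec r ;; inc s).

(** The loop empties [r]; the scratch counter [t], zero before and after, carries its value back. *)
Definition copy r s t := loop r (dec r ;; inc s ;; inc t) ;; add t r.

Definition double r t := loop r (dec r ;; inc t ;; inc t) ;; add t r.

Definition clear r := loop r (dec r).

(** Forms [2 * r + 1] and doubles it [x] times, which gives [cons_code x r]. *)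
Definition push r x t :=
  loop r (dec r ;; inc t ;; inc t) ;; inc t ;; add t r ;; loop x (dec x ;; double r t).

(** The quotient goes to [t]; [e] is decremented exactly when [r] is odd. *)
Definition half r e t := loop r (dec r ;; If (Some r) (dec e) (dec r ;; inc t)).

(** Halves [r] and increments [x] until an odd value is met, whose halving clears the flag [e] and
    leaves the tail. Zero codes the empty list and is left alone. *)
Definition pop r x e t :=
  If (Some r) Skip
    (inc e ;; loop e (half r e t ;; add t r ;; If (Some e) Skip (inc x))).

Ltac upd_eq :=
  let x := fresh in
  rewrite /=; move=> x; rewrite /upd; repeat (case: eqP => ?; subst); try congruence; try lia.

Ltac upd_val := rewrite /upd; repeat (case: eqP => ?; subst); try congruence; try lia.

Lemma runs_clear r a : runs (clear r) a (upd a r 0).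
Proof.
move Ea: (a r) => n; elim: n a Ea => [|n IHn] a Ea.
  by apply: runs_eq (@runs_until0 r _ a Ea) _; upd_eq.
apply: runs_untilS; [by rewrite Ea | exact: runs_dec |].
by apply: runs_eq (IHn _ _) _; [upd_val | upd_eq].
Qed.

Lemma runs_add r s a : r != s -> runs (add r s) a (upd (upd a s (a s + a r)) r 0).
Proof.
move/eqP=> rs; move Ea: (a r) => n; elim: n a Ea => [|n IHn] a Ea.
  by apply: runs_eq (@runs_until0 r _ a Ea) _; upd_eq.
apply: runs_untilS; [by rewrite Ea | |].
  by apply: runs_seq; [exact: runs_dec | exact: runs_inc].
by apply: runs_eq (IHn _ _) _; [upd_val | upd_eq].
Qed.

Lemma runs_copy r s t a : r != s -> r != t -> s != t -> a t = 0 ->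
  runs (copy r s t) a (upd a s (a s + a r)).
Proof.
move=> rs rt st at0; apply: (@runs_seq _ _ _ (upd (upd (upd a s (a s + a r)) t (a t + a r)) r 0)).
  move/eqP: rs => rs; move/eqP: rt => rt; move/eqP: st => st {at0}.
  move Ea: (a r) => n; elim: n a Ea => [|n IHn] a Ea.
    by apply: runs_eq (@runs_until0 r _ a Ea) _; upd_eq.
  apply: runs_untilS; [by rewrite Ea | |].
    apply: runs_seq; [exact: runs_dec |].
    by apply: runs_seq; exact: runs_inc.
  by apply: runs_eq (IHn _ _) _; [upd_val | upd_eq].
apply: runs_eq (@runs_add _ _ _ _) _; first by rewrite eq_sym.
by move/eqP: rs => rs; move/eqP: rt => rt; move/eqP: st => st; upd_eq.
Qed.

Lemma runs_transfer2 r t a : r != t ->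
  runs (loop r (dec r ;; inc t ;; inc t)) a (upd (upd a t (a t + (a r).*2)) r 0).
Proof.
move/eqP=> rt; move Ea: (a r) => n; elim: n a Ea => [|n IHn] a Ea.
  by apply: runs_eq (@runs_until0 r _ a Ea) _; upd_eq.
apply: runs_untilS; [by rewrite Ea | |].
  apply: runs_seq; [exact: runs_dec |].
  by apply: runs_seq; exact: runs_inc.
by apply: runs_eq (IHn _ _) _; [upd_val | upd_eq].
Qed.

Lemma runs_double r t a : r != t -> a t = 0 -> runs (double r t) a (upd a r (a r).*2).
Proof.
move=> rt at0; apply: runs_seq (@runs_transfer2 _ _ _ rt) _.
apply: runs_eq (@runs_add _ _ _ _) _; first by rewrite eq_sym.
by move/eqP: rt => rt; upd_eq.
Qed.

Lemma runs_scale r x t a : r != x -> r != t -> x != t -> a t = 0 ->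
  runs (loop x (dec x ;; double r t)) a (upd (upd a r (2 ^ a x * a r)) x 0).
Proof.
move=> rx rt xt; have /eqP rxF := rx; have /eqP rtF := rt; have /eqP xtF := xt.
move Ea: (a x) => n; elim: n a Ea => [|n IHn] a Ea at0.
  by apply: runs_eq (@runs_until0 x _ a Ea) _; rewrite expn0 mul1n; upd_eq.
apply: runs_untilS; [by rewrite Ea | |].
  apply: runs_seq; [exact: runs_dec |].
  by apply: runs_double => //; upd_val.
apply: runs_eq (IHn _ _ _) _; try by upd_val.
by rewrite expnS; upd_eq; rewrite -mul2n; lia.
Qed.

Lemma runs_push r x t a : r != x -> r != t -> x != t -> a t = 0 ->
  runs (push r x t) a (upd (upd a r (cons_code (a x) (a r))) x 0).
Proof.
move=> rx rt xt at0; have tr : t != r by rewrite eq_sym.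
have /eqP rxF := rx; have /eqP rtF := rt; have /eqP xtF := xt.
apply: runs_seq (@runs_transfer2 _ _ _ rt) _.
apply: runs_seq (@runs_inc _ _) _.
apply: runs_seq (@runs_add _ _ _ tr) _.
apply: runs_eq (@runs_scale _ _ _ _ rx rt xt _) _; first by upd_val.
rewrite /cons_code => y; rewrite /upd !eqxx (negbTE rt) (negbTE tr) [x == r]eq_sym (negbTE rx).
rewrite ?(negbTE xt) ?at0 ?add0n ?addn0.
by repeat (case: eqP => ?; subst).
Qed.

Lemma runs_half_even r e t a m : r != e -> r != t -> e != t -> a r = m.*2 ->
  runs (half r e t) a (upd (upd a r 0) t (a t + m)).
Proof.
move=> /eqP re /eqP rt /eqP et; elim: m a => [|m IHm] a Ea.
  by apply: runs_eq (@runs_until0 r _ a Ea) _; upd_eq.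
apply: runs_untilS; [by rewrite Ea | |].
  apply: runs_seq; [exact: runs_dec |].
  apply: runs_ifS; first by upd_val.
  by apply: runs_seq; [exact: runs_dec | exact: runs_inc].
by apply: runs_eq (IHm _ _) _; [upd_val | upd_eq].
Qed.

Lemma runs_half_odd r e t a m : r != e -> r != t -> e != t -> a r = m.*2.+1 -> a e = 1 ->
  runs (half r e t) a (upd (upd (upd a r 0) t (a t + m)) e 0).
Proof.
move=> /eqP re /eqP rt /eqP et; elim: m a => [|m IHm] a Ea ae.
  apply: runs_untilS; [by rewrite Ea | |].
    apply: runs_seq; [exact: runs_dec |].
    by apply: runs_if0; [upd_val | exact: runs_dec].
  by apply: runs_eq (@runs_until0 r _ _ _) _; [upd_val | upd_eq].
apply: runs_untilS; [by rewrite Ea | |].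
  apply: runs_seq; [exact: runs_dec |].
  apply: runs_ifS; first by upd_val.
  by apply: runs_seq; [exact: runs_dec | exact: runs_inc].
by apply: runs_eq (IHm _ _ _) _; [upd_val | upd_val | upd_eq].
Qed.

Lemma runs_pop_cons r x e t a n m :
  r != x -> r != e -> r != t -> x != e -> x != t -> e != t ->
  a r = cons_code n m -> a e = 0 -> a t = 0 ->
  runs (pop r x e t) a (upd (upd a r m) x (a x + n)).
Proof.
move=> rx re rt xe xt et ar ae0 at0.
apply: runs_ifS; first by rewrite ar cons_code_gt0.
apply: runs_seq (@runs_inc _ _) _; set a1 := upd a e _.
have a1e : a1 e = 1 by rewrite /a1 /upd eqxx ae0.
have a1r : a1 r = cons_code n m by rewrite /a1 /upd (negbTE re).
have a1t : a1 t = 0 by rewrite /a1 /upd eq_sym (negbTE et).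
(* The target is restated from [a1], where the flag is set, with a final reset of the flag: this
   form goes through the induction on [n]. *)
have -> : upd (upd a r m) x (a x + n) = upd (upd (upd a1 r m) e (a e)) x (a1 x + n).
  rewrite /a1; move/eqP: rx => rx; move/eqP: re => re; move/eqP: xe => xe.
  by apply: funext; upd_eq.
rewrite ae0; have tr : t != r by rewrite eq_sym.
have er : e != r by rewrite eq_sym.
have /eqP erF := er; have /eqP trF := tr; have /eqP rxF := rx; have /eqP xeF := xe.
have /eqP xtF := xt; have /eqP etF := et.
clearbody a1; elim: n a1 a1r a1e a1t {a ar ae0 at0} => [|n IHn] a ar ae at0.
  rewrite /cons_code expn0 mul1n in ar.
  apply: runs_untilS; first by rewrite ae.
    apply: runs_seq (@runs_half_odd _ _ _ _ _ re rt et ar ae) _.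
    apply: runs_seq (@runs_add _ _ _ tr) _.
    by apply: runs_if0; [upd_val | exact: runs_skip].
  by apply: runs_eq (@runs_until0 e _ _ _) _; [upd_val | upd_eq].
have {}ar : a r = (cons_code n m).*2 by rewrite ar /cons_code expnS -mulnA mul2n.
apply: runs_untilS; first by rewrite ae.
  apply: runs_seq (@runs_half_even _ _ _ _ _ re rt et ar) _.
  apply: runs_seq (@runs_add _ _ _ tr) _.
  by apply: runs_ifS; [upd_val | exact: runs_inc].
by apply: runs_eq (IHn _ _ _ _) _; [upd_val | upd_val | upd_val | upd_eq].
Qed.

Lemma runs_pop r x e t a v :
  r != x -> r != e -> r != t -> x != e -> x != t -> e != t ->
  a r = code v -> a e = 0 -> a t = 0 ->
  runs (pop r x e t) a (upd (upd a r (code (behead v))) x (a x + head 0 v)).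
Proof.
move=> rx re rt xe xt et; case: v => [|n v] ar ae at0; last exact: runs_pop_cons.
apply: runs_if0 => //; apply: runs_eq (@runs_skip a) _ => y.
by move/eqP: rx => rx; rewrite /upd /=; repeat (case: eqP => ?; subst); rewrite ?addn0.
Qed.
End Counters.

(** * An interpreter with eleven counters *)

Definition rN : 'I_11 := @Ordinal 11 0 isT.
Definition rP : 'I_11 := @Ordinal 11 1 isT.
Definition rK : 'I_11 := @Ordinal 11 2 isT.
Definition rX : 'I_11 := @Ordinal 11 3 isT.
Definition rS : 'I_11 := @Ordinal 11 4 isT.
Definition rD : 'I_11 := @Ordinal 11 5 isT.
Definition rA : 'I_11 := @Ordinal 11 6 isT.
Definition rB : 'I_11 := @Ordinal 11 7 isT.
Definition rU : 'I_11 := @Ordinal 11 8 isT.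
Definition rE : 'I_11 := @Ordinal 11 9 isT.
Definition rT : 'I_11 := @Ordinal 11 10 isT.

(** [rN] keeps the input, [rP], [rK], [rX], [rS] hold the interpreted state, [rD] is the flag of the
    main loop; the other five are scratch counters, zero between instructions. *)
Definition regs (n p k x s d : nat) : 'I_11 -> nat := fun r =>
  match val r with 0 => n | 1 => p | 2 => k | 3 => x | 4 => s | 5 => d | _ => 0 end.

Ltac reg_eq :=
  let r := fresh "r" in let i := fresh "i" in let Hi := fresh "Hi" in
  intro r; destruct r as [i Hi]; rewrite /upd /regs -!val_eqE /=;
  do 11 (destruct i as [|i]; [by rewrite /= ?addKn ?addn0 ?add0n // |]); by [].

Fixpoint incs m r : cmd (option 'I_11) := if m is m'.+1 then inc r ;; incs m' r else Skip.

(** A selected entry runs with [r] at zero, the default with [r] reduced by the number of entries;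
    for opcode [8 + c] the excess [c] is the code of a loop body. *)
Fixpoint dispatch r (ops : seq (cmd (option 'I_11))) default :=
  if ops is o :: ops' then If (Some r) o (dec r ;; dispatch r ops' default) else default.

(** To enter the loop, the opcode [8 + c] is put back in front of the current stream, that stream is
    suspended on [rK], and the body [c] becomes current. *)
Definition op_while : cmd (option 'I_11) :=
  copy rX rB rT ;; pop rB rU rE rT ;; clear rB ;;
  If (Some rU) (clear rA)
    (clear rU ;; copy rA rU rT ;; incs 8 rU ;; push rP rU rT ;; push rK rP rT ;; add rA rP).

Definition ops : seq (cmd (option 'I_11)) :=
  [:: clear rX; inc rX; dec rX;
      pop rX rB rE rT ;; clear rX ;; add rB rX;
      pop rX rB rE rT ;; clear rB;
      copy rX rB rT ;; push rS rB rT;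
      pop rS rB rE rT ;; push rS rX rT ;; add rB rX;
      pop rS rB rE rT ;; push rB rX rT ;; add rB rX].

Definition interp_body : cmd (option 'I_11) :=
  If (Some rP) (If (Some rK) (dec rD) (pop rK rP rE rT))
    (pop rP rA rE rT ;; dispatch rA ops op_while).

Definition interp_run : cmd (option 'I_11) :=
  copy rN rP rT ;; copy rN rX rT ;; inc rD ;; loop rD interp_body.

(* A nonzero final value makes the head leave the segment on the left. *)
Definition interp : cmd (option 'I_11) := interp_run ;; loop rX MoveL.

(* An instruction stream [p], a stack [k] of suspended streams, the current value [x] and a
   stack [s] of saved values; lists are coded by [code]. *)
Inductive istep : nat -> nat -> nat -> nat -> nat -> nat -> nat -> nat -> Prop :=
| istep_return p k x s : istep 0 (cons_code p k) x s p k x s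
| istep_zero p k x s : istep (cons_code 0 p) k x s p k 0 s
| istep_succ p k x s : istep (cons_code 1 p) k x s p k x.+1 s
| istep_pred p k x s : istep (cons_code 2 p) k x s p k x.-1 s
| istep_head p k v s :
    istep (cons_code 3 p) k (code v) s p k (head 0 v) s
| istep_tail p k v s :
    istep (cons_code 4 p) k (code v) s p k (code (behead v)) s
| istep_dup p k x s : istep (cons_code 5 p) k x s p k x (cons_code x s)
| istep_swap p k x y s :
    istep (cons_code 6 p) k x (cons_code y s) p k y (cons_code x s)
| istep_cons p k x y s :
    istep (cons_code 7 p) k x (cons_code y s) p k (cons_code x y) s
| istep_exit c p k v s : head 0 v = 0 ->
    istep (cons_code (8 + c) p) k (code v) s p k (code v) s
| istep_enter c p k v s : 0 < head 0 v ->
    istep (cons_code (8 + c) p) k (code v) s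
      c (cons_code (cons_code (8 + c) p) k) (code v) s.

Section Interpreter.
Variables (main : cmd (option 'I_11)) (clean : bool).
Local Notation runs := (runs main clean).

Lemma runs_incs m r a : runs (incs m r) a (upd a r (a r + m)).
Proof.
elim: m a => [|m IHm] a.
  by apply: runs_eq (@runs_skip _ _ _ a) _ => x; rewrite /upd addn0; case: eqP => // ->.
apply: runs_seq (@runs_inc _ _ _ _ _) _; apply: runs_eq (IHm _) _ => x.
by rewrite /upd; case: eqP => // _; rewrite eqxx addSnnS.
Qed.

Lemma runs_dispatch r os e a b :
  (a r < size os -> runs (nth Skip os (a r)) (upd a r 0) b) ->
  (size os <= a r -> runs e (upd a r (a r - size os)) b) ->
  runs (dispatch r os e) a b.
Proof.
elim: os a => [|o os IHos] a H1 H2 /=.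
  have := H2 isT; rewrite subn0 (_ : upd a r (a r) = a) //.
  by apply: funext => x; rewrite /upd; case: eqP => // ->.
case: (posnP (a r)) => [r0|r_gt0].
  apply: runs_if0 => //; move: H1; rewrite r0 => /(_ isT) /=.
  rewrite (_ : upd a r 0 = a) //.
  by apply: funext => x; rewrite /upd; case: eqP => // ->.
apply: runs_ifS => //; apply: runs_seq (@runs_dec _ _ _ _ _) _.
have updupd v : upd (upd a r (a r).-1) r v = upd a r v.
  by apply: funext => x; rewrite /upd; case: eqP.
have ar1 : upd a r (a r).-1 r = (a r).-1 by rewrite /upd eqxx.
apply: IHos; rewrite ar1 updupd => H.
  by have := H1; rewrite -(prednK r_gt0) /= ltnS => /(_ H).
by have := H2; rewrite -(prednK r_gt0) /= ltnS subSS => /(_ H).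
Qed.

(** One instruction is one round of the main loop; the scratch counters are zero again at its end,
    so rounds can be chained. *)
Lemma runs_istep n p k x s p' k' x' s' :
  istep p k x s p' k' x' s' ->
  runs interp_body (regs n p k x s 1) (regs n p' k' x' s' 1).
Proof.
have fetch i q k0 x0 s0 b : runs (dispatch rA ops op_while)
      (upd (regs n q k0 x0 s0 1) rA i) b ->
    runs interp_body (regs n (cons_code i q) k0 x0 s0 1) b.
  move=> H; apply: runs_ifS; first exact: cons_code_gt0.
  apply: runs_seq (@runs_pop_cons _ _ _ _ _ _ _ _ i q _ _ _ _ _ _ _ _ _) _ => //.
  rewrite (_ : upd _ _ _ = upd (regs n q k0 x0 s0 1) rA i) //.
  by apply: funext; reg_eq.
have op i q k0 x0 s0 b : i < size ops ->
    runs (nth Skip ops i) (regs n q k0 x0 s0 1) b ->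
    runs interp_body (regs n (cons_code i q) k0 x0 s0 1) b.
  move=> li H; apply: fetch; apply: runs_dispatch; rewrite /upd eqxx => Hi; last first.
    by move: li; rewrite ltnNge Hi.
  by apply: runs_eql H; reg_eq.
have opw c q k0 x0 s0 b : runs op_while (upd (regs n q k0 x0 s0 1) rA c) b ->
    runs interp_body (regs n (cons_code (8 + c) q) k0 x0 s0 1) b.
  move=> H; apply: fetch; apply: runs_dispatch => [|_]; first by rewrite /upd eqxx.
  by apply: runs_eql H; reg_eq.
case=> {p k x s p' k' x' s'}.
- move=> p k x s; apply: runs_if0 => //; apply: runs_ifS; first exact: cons_code_gt0.
  apply: runs_eq (@runs_pop_cons _ _ _ _ _ _ _ _ p k _ _ _ _ _ _ _ _ _) _ => //.
  by reg_eq.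
- move=> p k x s; apply: op => //=.
  by apply: runs_eq (@runs_clear _ _ _ _ _) _ => //; reg_eq.
- move=> p k x s; apply: op => //=.
  by apply: runs_eq (@runs_inc _ _ _ _ _) _ => //; reg_eq.
- move=> p k x s; apply: op => //=.
  by apply: runs_eq (@runs_dec _ _ _ _ _) _ => //; reg_eq.
- move=> p k v s; apply: op => //=.
  apply: runs_seq (@runs_pop _ _ _ _ _ _ _ _ v _ _ _ _ _ _ _ _ _) _ => //.
  apply: runs_seq (@runs_clear _ _ _ _ _) _.
  by apply: runs_eq (@runs_add _ _ _ _ _ _ _) _ => //; reg_eq.
- move=> p k v s; apply: op => //=.
  apply: runs_seq (@runs_pop _ _ _ _ _ _ _ _ v _ _ _ _ _ _ _ _ _) _ => //.
  by apply: runs_eq (@runs_clear _ _ _ _ _) _ => //; reg_eq.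
- move=> p k x s; apply: op => //=.
  apply: runs_seq (@runs_copy _ _ _ _ _ _ _ _ _ _ _) _ => //.
  by apply: runs_eq (@runs_push _ _ _ _ _ _ _ _ _ _ _) _ => //; reg_eq.
- move=> p k x y s; apply: op => //=.
  apply: runs_seq (@runs_pop_cons _ _ _ _ _ _ _ _ y s _ _ _ _ _ _ _ _ _) _ => //.
  apply: runs_seq (@runs_push _ _ _ _ _ _ _ _ _ _ _) _ => //.
  by apply: runs_eq (@runs_add _ _ _ _ _ _ _) _ => //; reg_eq.
- move=> p k x y s; apply: op => //=.
  apply: runs_seq (@runs_pop_cons _ _ _ _ _ _ _ _ y s _ _ _ _ _ _ _ _ _) _ => //.
  apply: runs_seq (@runs_push _ _ _ _ _ _ _ _ _ _ _) _ => //.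
  by apply: runs_eq (@runs_add _ _ _ _ _ _ _) _ => //; reg_eq.
- move=> c p k v s v0; apply: opw; rewrite /op_while.
  apply: runs_seq (@runs_copy _ _ _ _ _ _ _ _ _ _ _) _ => //.
  apply: runs_seq (@runs_pop _ _ _ _ _ _ _ _ v _ _ _ _ _ _ _ _ _) _ => //.
  apply: runs_seq (@runs_clear _ _ _ _ _) _.
  apply: runs_if0; first by rewrite /upd /= v0.
  by apply: runs_eq (@runs_clear _ _ _ _ _) _; rewrite v0; reg_eq.
- move=> c p k v s v0; apply: opw; rewrite /op_while.
  apply: runs_seq (@runs_copy _ _ _ _ _ _ _ _ _ _ _) _ => //.
  apply: runs_seq (@runs_pop _ _ _ _ _ _ _ _ v _ _ _ _ _ _ _ _ _) _ => //.
  apply: runs_seq (@runs_clear _ _ _ _ _) _.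
  apply: runs_ifS; first by rewrite /upd /=.
  apply: runs_seq (@runs_clear _ _ _ _ _) _.
  apply: runs_seq (@runs_copy _ _ _ _ _ _ _ _ _ _ _) _ => //.
  apply: runs_seq (@runs_incs _ _ _) _.
  apply: runs_seq (@runs_push _ _ _ _ _ _ _ _ _ _ _) _ => //.
  apply: runs_seq (@runs_push _ _ _ _ _ _ _ _ _ _ _) _ => //.
  apply: runs_eq (@runs_add _ _ _ _ _ _ _) _ => //.
  by rewrite [8 + c]addnC; reg_eq.
Qed.
End Interpreter.

(** * Compiling recursive functions *)

Inductive istar : nat -> nat -> nat -> nat -> nat -> nat -> nat -> nat -> Prop :=
| istar_refl p k x s : istar p k x s p k x s
| istar_step p k x s p1 k1 x1 s1 p' k' x' s' : istep p k x s p1 k1 x1 s1 ->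
    istar p1 k1 x1 s1 p' k' x' s' -> istar p k x s p' k' x' s'.

Lemma istar_trans p k x s p1 k1 x1 s1 p' k' x' s' :
  istar p k x s p1 k1 x1 s1 -> istar p1 k1 x1 s1 p' k' x' s' ->
  istar p k x s p' k' x' s'.
Proof.
by move=> H; elim: H p' k' x' s' => // *; apply: istar_step; eauto.
Qed.

Lemma runs_interp_loop main clean n p k x s y :
  istar p k x s 0 0 y 0 ->
  runs main clean (loop rD interp_body) (regs n p k x s 1) (regs n 0 0 y 0 0).
Proof.
have halt x0 : runs main clean (loop rD interp_body) (regs n 0 0 x0 0 1) (regs n 0 0 x0 0 0).
  apply: runs_untilS => //.
    by apply: runs_if0 => //; apply: runs_if0 => //; exact: runs_dec.
  by apply: runs_eq (@runs_until0 _ _ _ _ _ _ _) _ => //; reg_eq.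
(* The final state is generalized to variables for the induction on [istar]. *)
suff H p' k' s' : istar p k x s p' k' y s' -> p' = 0 -> k' = 0 -> s' = 0 ->
    runs main clean (loop rD interp_body) (regs n p k x s 1) (regs n 0 0 y 0 0).
  by move=> st; apply: H st _ _ _.
elim=> {p k x s p' k' y s'} [p k x s -> -> -> | p k x s p1 k1 x1 s1 p' k' x' s' st _ IH].
  exact: halt.
move=> ep ek es; apply: runs_untilS (@runs_istep _ _ n _ _ _ _ _ _ _ _ st) _ => //.
exact: IH.
Qed.

(** Program and input are both copies of [rN], which keeps its value: on result [0] the counters end
    as they began. *)
Lemma runs_interp_run main clean n y : istar n 0 n 0 0 0 y 0 ->
  runs main clean interp_run (regs n 0 0 0 0 0) (regs n 0 0 y 0 0).
Proof.
move=> H; apply: runs_seq (@runs_copy _ _ _ _ _ _ _ _ _ _ _) _ => //.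
apply: runs_seq (@runs_copy _ _ _ _ _ _ _ _ _ _ _) _ => //.
apply: runs_seq (@runs_inc _ _ _ _ _) _.
by apply: runs_eql (@runs_interp_loop _ _ _ _ _ _ _ _ H); reg_eq.
Qed.

(** * The initial tape: return or failure *)

Definition tape0 (n : nat) : tape (option 'I_11) := fun p =>
  [ffun j => if j is Some r then p == regs n 0 0 0 0 0 r else p == 0].

Lemma represents_tape0 clean n : represents clean (tape0 n) (regs n 0 0 0 0 0).
Proof. by move=> r p _; rewrite !ffunE. Qed.

(** Without garbage the counters determine the whole tape, so recovering their values means
    recovering the same machine state. *)
Lemma represents_tape0_unique n t : represents true t (regs n 0 0 0 0 0) -> t = tape0 n.
Proof.
move=> H; apply: funext => p; apply/ffunP => j; rewrite ffunE.
case: j => [r|]; first by have [] := H r p isT.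
by have [] := H rN p isT.
Qed.

(** No counter exceeds [n], so [n.+1] cells fix everything that [represents false] asks for; the
    rest of the tape is free. *)
Lemma represents_agree n (t : tape (option 'I_11)) :
  (forall i, i < n.+1 -> t i = tape0 n i) -> represents false t (regs n 0 0 0 0 0).
Proof.
move=> H r p /= le; rewrite H ?ffunE //.
rewrite ltnS (leq_trans le) // /regs.
by case: (val r) => [|[|[|[|[|[|]]]]]].
Qed.

Lemma interp_period n : istar n 0 n 0 0 0 0 0 -> exists2 m, 0 < m &
  miter interp m ([:: interp], 0, tape0 n) = Some ([:: interp], 0, tape0 n).
Proof.
move=> st; have H := @runs_seq _ interp true _ _ _ _ _ (@runs_interp_run _ _ _ _ st)
  (@runs_until0 _ interp true rX MoveL (regs n 0 0 0 0 0) erefl).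
have [t /represents_tape0_unique -> [m Hm]] := H _ [::] (@represents_tape0 true n).
(* The extra step replaces the empty stack by [[:: interp]]. *)
exists m.+1 => //; rewrite /miter iterS -/(miter _ _ _) Hm /=.
by rewrite overwrite_same.
Qed.

Lemma interp_fail n y : istar n 0 n 0 0 0 y 0 -> 0 < y ->
  forall t, (forall i, i < n.+1 -> t i = tape0 n i) ->
  exists m, miter interp m ([:: interp], 0, t) = None.
Proof.
move=> st y0 t /represents_agree tn.
have [t1 t1y R1] := @runs_interp_run interp false n y st t [:: loop rX MoveL] tn.
have [m Hm] : reach interp ([:: interp], 0, t) ([:: MoveL; loop rX MoveL], 0, t1).
  apply: reach_seq; apply: reach_trans R1 _.
  have := reach_until interp (Some rX) MoveL [::] 0 t1.
  by rewrite (represents_zero _ t1y) /= eqn0Ngt y0.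
by exists m.+1; rewrite /miter iterS -/(miter _ _ _) Hm.
Qed.

Definition append_code (l : seq nat) (p : nat) := foldr cons_code p l.

(** The rest of the stream and both stacks are arbitrary, so that programs compose by
    concatenation. *)
Definition computes (l : seq nat) (x y : nat) := forall p k s,
  istar (append_code l p) k x s p k y s.

Lemma computes_step i x y :
  (forall p k s, istep (cons_code i p) k x s p k y s) -> computes [:: i] x y.
Proof. by move=> H p k s; apply: istar_step (H _ _ _) (istar_refl _ _ _ _). Qed.

Lemma computes_nil x : computes [::] x x.
Proof. by move=> p k s; apply: istar_refl. Qed.

Lemma computes_cat l1 l2 x y z :
  computes l1 x y -> computes l2 y z -> computes (l1 ++ l2) x z.
Proof.
move=> H1 H2 p k s; rewrite /append_code foldr_cat.
by apply: istar_trans (H1 _ _ _) (H2 _ _ _).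
Qed.

Lemma computes_seq i l x y z :
  computes [:: i] x y -> computes l y z -> computes (i :: l) x z.
Proof. exact: (@computes_cat [:: i]). Qed.

Lemma computes_zero x : computes [:: 0] x 0.
Proof. by apply: computes_step => *; apply: istep_zero. Qed.

Lemma computes_succ x : computes [:: 1] x x.+1.
Proof. by apply: computes_step => *; apply: istep_succ. Qed.

Lemma computes_pred x : computes [:: 2] x x.-1.
Proof. by apply: computes_step => *; apply: istep_pred. Qed.

Lemma computes_head v : computes [:: 3] (code v) (head 0 v).
Proof. by apply: computes_step => *; apply: istep_head. Qed.

Lemma computes_tail v : computes [:: 4] (code v) (code (behead v)).
Proof. by apply: computes_step => *; apply: istep_tail. Qed.

Lemma computes_const a x : computes (0 :: nseq a 1) x a.
Proof.
have add m : computes (nseq a 1) m (m + a).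
  elim: a m => [|a IHa] m; first by rewrite addn0; apply: computes_nil.
  by apply: computes_seq (computes_succ m) _; rewrite -addSnnS.
exact: computes_seq (computes_zero x) (add 0).
Qed.

Lemma computes_drop i v : computes (nseq i 4) (code v) (code (drop i v)).
Proof.
elim: i v => [|i IHi] v; first by rewrite drop0; apply: computes_nil.
by apply: computes_seq (computes_tail v) _; case: v => [|x v] //=; apply: (IHi [::]).
Qed.

(** The argument is saved and [l2] runs; a swap brings the argument back for [l1], and the two
    results are joined. *)
Definition pair_prog (l1 l2 : seq nat) := 5 :: l2 ++ 6 :: l1 ++ [:: 7].

Lemma computes_pair l1 l2 x y1 y2 : computes l1 x y1 -> computes l2 x y2 ->
  computes (pair_prog l1 l2) x (cons_code y1 y2).
Proof.
move=> H1 H2 p k s; rewrite /append_code /= foldr_cat /= foldr_cat.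
apply: istar_step (istep_dup _ _ _ _) _.
apply: istar_trans (H2 _ _ _) _.
apply: istar_step (istep_swap _ _ _ _ _) _.
apply: istar_trans (H1 _ _ _) _.
exact: istar_step (istep_cons _ _ _ _ _) (istar_refl _ _ _ _).
Qed.

Definition loop_prog (l : seq nat) := [:: 8 + code l].

Lemma computes_loop_exit l v :
  head 0 v = 0 -> computes (loop_prog l) (code v) (code v).
Proof. by move=> v0; apply: computes_step => *; apply: istep_exit. Qed.

Lemma computes_loop_enter l v y z : 0 < head 0 v -> computes l (code v) y ->
  computes (loop_prog l) y z -> computes (loop_prog l) (code v) z.
Proof.
move=> v0 H1 H2 p k s; apply: istar_step (istep_enter _ _ _ _ v0) _.
(* The body runs as a stream of its own, ended by [0]; its return resumes the suspended stream at
   the loop instruction. *)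
apply: istar_trans (H1 0 _ _) _.
by apply: istar_step (istep_return _ _ _ _) (H2 _ _ _).
Qed.

(** The loop state is [[:: m, i, z & v]]: rounds left, recursion index, value at that index,
    parameters. *)
Definition prec_body (lg : seq nat) :=
  pair_prog [:: 3; 2] (pair_prog [:: 4; 3; 1] (pair_prog (4 :: lg) [:: 4; 4; 4])).

(** The loop state is [[:: k, j & v]] with [k] the value at [j :: v]; one round passes to [j.+1]. *)
Definition mu_body (lf : seq nat) :=
  4 :: pair_prog [:: 3; 1] [:: 4] ++ pair_prog lf [::].

Fixpoint compile (f : recf) : seq nat :=
  match f with
  | rZero => [:: 0]
  | rSucc => [:: 3; 1]
  | rProj i => nseq i 4 ++ [:: 3]
  | rComp f gs => foldr (fun g l => pair_prog (compile g) l) [:: 0] gs ++ compile f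
  | rPrec f g =>
      pair_prog [:: 3] (pair_prog [:: 0] (pair_prog (4 :: compile f) [:: 4]))
      ++ loop_prog (prec_body (compile g)) ++ [:: 4; 4; 3]
  | rMu f =>
      pair_prog [:: 0] [::] ++ pair_prog (compile f) [::]
      ++ loop_prog (mu_body (compile f)) ++ [:: 4; 3]
  end.

Definition correct f := forall v y, reval f v y -> computes (compile f) (code v) y.

(** Adds the induction hypotheses for the functions inside the list of [rComp]. *)
Lemma recf_ind_nested (P : recf -> Prop) :
  P rZero -> P rSucc -> (forall i, P (rProj i)) ->
  (forall f gs, P f -> List.Forall P gs -> P (rComp f gs)) ->
  (forall f g, P f -> P g -> P (rPrec f g)) ->
  (forall f, P f -> P (rMu f)) -> forall f, P f.
Proof.
move=> H0 H1 Hi Hc Hp Hm; fix IH 1; case=> [||i|f gs|f g|f].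
- exact: H0.
- exact: H1.
- exact: Hi.
- by apply: Hc => //; elim: gs => [|g gs IHgs]; constructor.
- exact: Hp.
- exact: Hm.
Qed.

Lemma correct_comp f gs : correct f -> List.Forall correct gs -> correct (rComp f gs).
Proof.
move=> Hf Hgs v y H; inversion_clear H.
apply: computes_cat (Hf _ _ H1).
elim: H0 Hgs => [|g z {}gs zs gz _ IHzs] Hgs /=; first exact: computes_zero.
inversion_clear Hgs; apply: computes_pair (IHzs _) => //.
exact: H.
Qed.

Lemma correct_prec f g : correct f -> correct g -> correct (rPrec f g).
Proof.
move=> Hf Hg v y; case: v => [|n v] H; first by inversion H.
(* The loop started at [[:: n + m, 0, z0 & v]] passes through [[:: m, n, y & v]]; this is phrased on
   final results to allow induction on [n]. *)
have [z0 Hz0 Hloop] : exists2 z0, computes (compile f) (code v) z0 &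
    forall m w, computes (loop_prog (prec_body (compile g))) (code [:: m, n, y & v]) w ->
      computes (loop_prog (prec_body (compile g))) (code [:: n + m, 0, z0 & v]) w.
  elim: n y H => [|n IHn] y H; inversion_clear H; first by exists y => //; exact: Hf.
  have [z0 Hz0 Hl] := IHn _ H0; exists z0 => // m w Hw; rewrite addSnnS; apply: Hl.
  apply: computes_loop_enter (Hw) => //.
  apply: computes_pair; first exact: computes_seq (@computes_head _) (@computes_pred _).
  apply: computes_pair.
    apply: computes_seq (@computes_tail _) _.
    exact: computes_seq (@computes_head _) (@computes_succ _).
  apply: computes_pair; first by apply: computes_seq (@computes_tail _) _; apply: Hg.
  apply: computes_seq (@computes_tail _) _.
  exact: computes_seq (@computes_tail _) (@computes_tail _).
apply: computes_cat.
  apply: computes_pair; first exact: computes_head.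
  apply: computes_pair; first exact: computes_zero.
  exact: computes_pair (computes_seq (@computes_tail (n :: v)) Hz0) (@computes_tail (n :: v)).
apply: computes_cat; first by have := Hloop 0 _ (@computes_loop_exit _ _ _); rewrite addn0; apply.
apply: computes_seq (@computes_tail _) _.
exact: computes_seq (@computes_tail _) (@computes_head _).
Qed.

Lemma correct_mu f : correct f -> correct (rMu f).
Proof.
move=> Hf v n H; inversion_clear H.
(* Induction on the distance [d] from the current candidate [j] to the minimum [n]. *)
have Hl d j : j + d = n -> exists2 k, reval f (j :: v) k &
    computes (loop_prog (mu_body (compile f))) (code [:: k, j & v]) (code [:: 0, n & v]).
  elim: d j => [|d IHd] j ejn.
    by rewrite addn0 in ejn; subst j; exists 0 => //; apply: computes_loop_exit.
  have [k' Hk' Hloop] : exists2 k, reval f (j.+1 :: v) k &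
      computes (loop_prog (mu_body (compile f))) (code [:: k, j.+1 & v]) (code [:: 0, n & v]).
    by apply: IHd; rewrite addSnnS.
  have [k Hk] : exists k, reval f (j :: v) k.+1 by apply: H1; lia.
  exists k.+1 => //; apply: computes_loop_enter Hloop => //.
  apply: computes_seq (@computes_tail (k.+1 :: j :: v)) _.
  apply: (@computes_cat _ _ _ (code (j.+1 :: v))).
    apply: computes_pair (@computes_tail (j :: v)).
    exact: computes_seq (@computes_head (j :: v)) (@computes_succ j).
  exact: computes_pair (Hf _ _ Hk') (@computes_nil _).
have [k Hk Hloop] := Hl n 0 (add0n n).
apply: computes_cat; first exact: computes_pair (@computes_zero _) (@computes_nil _).
apply: computes_cat; first exact: computes_pair (Hf (0 :: v) _ Hk) (@computes_nil _).
apply: computes_cat Hloop _.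
exact: computes_seq (@computes_tail (0 :: n :: v)) (@computes_head (n :: v)).
Qed.

Theorem compile_correct f : correct f.
Proof.
elim/recf_ind_nested: f => [||i|f gs Hf Hgs|f g Hf Hg|f Hf].
- by move=> v y H; inversion_clear H; apply: computes_zero.
- move=> v y H; inversion_clear H.
  by rewrite nth0; apply: computes_seq (@computes_head v) (@computes_succ _).
- move=> v y H; inversion_clear H; apply: computes_cat (@computes_drop i v) _.
  by rewrite -[i in nth _ _ i]addn0 -nth_drop nth0; apply: computes_head.
- exact: correct_comp.
- exact: correct_prec.
- exact: correct_mu.
Qed.

Definition const_prog a := 0 :: nseq a 1.

(** The list is built from its last letter on, behind a countdown starting at [n.-1]; the program
    itself is independent of the input [n]. *)
Definition word_prog w h b m :=
  pair_prog [:: 2] (pair_prog (const_prog m) [:: 0])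
  ++ loop_prog (pair_prog [:: 3; 2] (pair_prog (const_prog b) [:: 4]))
  ++ 4 :: pair_prog (const_prog h) [::] ++ pair_prog (const_prog w) [::].

Lemma computes_word w h b m n :
  computes (word_prog w h b m) n (code [:: w, h & nseq n.-1 b ++ [:: m]]).
Proof.
have Hloop i a : computes (loop_prog (pair_prog [:: 3; 2] (pair_prog (const_prog b) [:: 4])))
    (code (i :: a)) (code (0 :: nseq i b ++ a)).
  elim: i a => [|i IHi] a; first exact: computes_loop_exit.
  (* A round adds its letter in front of [a], hence the split of the block at its right end. *)
  rewrite -[nseq i.+1 b]/(nseq (1 + i) b) addnC nseqD -catA.
  apply: computes_loop_enter (IHi (b :: a)) => //.
  apply: computes_pair.
    exact: computes_seq (@computes_head (i.+1 :: a)) (@computes_pred _).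
  exact: computes_pair (@computes_const _ _) (@computes_tail (i.+1 :: a)).
apply: computes_cat.
  apply: computes_pair (@computes_pred n) _.
  exact: computes_pair (@computes_const _ _) (@computes_zero _).
apply: computes_cat; first exact: (Hloop n.-1 [:: m]).
apply: computes_seq (@computes_tail (0 :: nseq n.-1 b ++ [:: m])) _.
apply: computes_cat; first exact: computes_pair (@computes_const _ _) (@computes_nil _).
exact: computes_pair (@computes_const _ _) (@computes_nil _).
Qed.

(** * Persistence *)

Import Order.TTheory GRing.Theory Num.Theory.

(** By independence the event has probability [(s / #|Q|) ^ n]; the denominators are cleared. *)
Lemma card_window (Q : finType) (M a n s : nat) (P : nat -> pred Q) :
  a + n <= M -> (forall i, a <= i < a + n -> #|P i| = s) ->
  #|[set W : M.-tuple Q |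
      [forall i : 'I_M, (a <= i < a + n) ==> P i (tnth W i)]]| * #|Q| ^ n
  = s ^ n * #|Q| ^ M.
Proof.
move=> anM Ps.
pose F (i : 'I_M) : pred Q := if a <= i < a + n then P i else predT.
have -> : #|[set W : M.-tuple Q |
      [forall i : 'I_M, (a <= i < a + n) ==> P i (tnth W i)]]| = #|family F|.
  rewrite -(card_imset _ (can_inj (@finfun_of_tupleK Q M))); apply: eq_card => f.
  apply/imsetP/familyP => [[W]|fF].
    rewrite inE => /forallP WP -> i; rewrite ffunE /F.
    by have := WP i; case: ifP.
  exists (tuple_of_finfun f); last by rewrite tuple_of_finfunK.
  rewrite inE; apply/forallP => i; apply/implyP => ai.
  by have := fF i; rewrite /F ai -{1}[f]tuple_of_finfunK ffunE.
rewrite card_family foldrE big_map big_enum /=.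
pose G i := if a <= i < a + n then s else #|Q|.
have -> : \prod_(i : 'I_M) #|F i| = \prod_(0 <= i < M) G i.
  rewrite big_mkord; apply: eq_bigr => i _; rewrite /F /G.
  by case: ifP => [/Ps //|_]; apply: eq_card => x; rewrite !inE.
have cst b c x : (forall i, b <= i < c -> G i = x) -> \prod_(b <= i < c) G i = x ^ (c - b).
  by move=> Gx; rewrite (eq_big_nat _ _ Gx) prod_nat_const_nat.
rewrite (big_cat_nat (leq0n a)) ?(leq_trans _ anM) ?leq_addr //=.
rewrite [\prod_(a <= i < M) _](@big_cat_nat _ _ _ (a + n)) ?leq_addr //=.
rewrite (cst 0 a #|Q|); last by move=> i /andP[_ ia]; rewrite /G leqNgt ia.
rewrite (cst a (a + n) s); last by move=> i ai; rewrite /G ai.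
rewrite (cst (a + n) M #|Q|); last first.
  by move=> i /andP[ani _]; rewrite /G [i < _]ltnNge ani andbF.
rewrite subn0 addKn -[in RHS](subnKC anM) !expnD.
by move: (#|Q| ^ a) (#|Q| ^ n) (s ^ n) (#|Q| ^ (M - _)) => x y z t; lia.
Qed.

(** Bernoulli's inequality for [(1 + 1 / s) ^ n], with denominators cleared. *)
Lemma bernoulli_nat s n : s ^ n * (s + n) <= s.+1 ^ n * s.
Proof.
elim: n => [|n IHn]; first by rewrite addn0.
apply: (@leq_trans (s.+1 * (s ^ n * (s + n)))); last first.
  by rewrite [s.+1 ^ _]expnS -mulnA leq_mul2l.
have H : s * (s + n.+1) <= s.+1 * (s + n) by lia.
by rewrite expnS mulnAC mulnCA [leqRHS]mulnC; apply: leq_mul.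
Qed.

Lemma pow_ratio_lt (s : nat) (eps : rat) : (0 < eps)%R ->
  exists n, ((s ^ n)%:R / (s.+1 ^ n)%:R < eps :> rat)%R.
Proof.
move=> eps0; pose n := (Num.bound (s%:R / eps)).+1; exists n.
have bn : (s%:R / eps < n%:R)%R.
  apply: lt_trans (Num.Theory.archi_boundP _) _; last by rewrite ltr_nat.
  by rewrite divr_ge0 ?ler0n ?ltW.
have H := bernoulli_nat s n.
rewrite ltr_pdivrMr ?ltr0n ?expn_gt0 //.
rewrite ltr_pdivrMr // in bn.
rewrite -(ltr_pM2r (_ : 0 < (s + n)%:R)%R) ?ltr0n ?addn_gt0 ?orbT //.
apply: (@le_lt_trans _ _ ((s.+1 ^ n)%:R * s%:R)%R); first by rewrite -!natrM ler_nat.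
rewrite -[ltRHS]mulrA [ltRHS]mulrCA ltr_pM2l ?ltr0n ?expn_gt0 //.
by rewrite natrD mulrDr ltr_wpDl ?mulr_ge0 ?ler0n ?(ltW eps0) // mulrC.
Qed.

(** * Persistence of the initial words *)

Section Persistence.
Variables (track : finType) (main : cmd track).
Local Notation Q := (cell main).

Definition ca_rule (f : {ffun 'I_(2 * 1 + 1) -> Q}) : Q :=
  local_rule (f (@Ordinal (2 * 1 + 1) 0 isT)) (f (@Ordinal (2 * 1 + 1) 1 isT))
    (f (@Ordinal (2 * 1 + 1) 2 isT)).

Local Notation F := (ca_global ca_rule).

Lemma ca_globalE (c : config Q) i :
  F c i = local_rule (c (i - 1)%R) (c i) (c (i + 1)%R).
Proof.
by rewrite /ca_global /ca_rule !ffunE /=; congr (local_rule (c _) (c _) (c _)); lia.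
Qed.

Lemma iter_ca_half (c : config Q) : c 0 = None -> forall n (i : nat),
  iter n F c (Posz i) = iter n (@half_step _ main) (fun j => c (Posz j)) i.
Proof.
move=> c0; elim=> // n IHn [|i]; rewrite !iterS ca_globalE.
  by rewrite IHn /= (@iter_half_step_wall _ _ n (fun j : nat => c j) 0).
have -> : (Posz i.+1 - 1 = Posz i)%R by lia.
have -> : (Posz i.+1 + 1 = Posz i.+2)%R by lia.
by rewrite !IHn.
Qed.

Lemma iter_ca_cell n (c : config Q) i : c i != None -> iter n F c i != None.
Proof.
move=> ci; elim: n => // n IHn; rewrite iterS ca_globalE.
pose g j := if j is j'.+1 then
  if j' is 0 then iter n F c i else iter n F c (i + 1)%R else iter n F c (i - 1)%R.
exact: (@half_step_cell _ main g 1).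
Qed.

(** The wall at [m] never changes, so nothing beyond it influences the cells before it. *)
Lemma half_step_local (g g' : nat -> Q) m : g m = None ->
  (forall i, i <= m -> g i = g' i) ->
  forall n i, i <= m -> iter n (@half_step _ main) g i = iter n (@half_step _ main) g' i.
Proof.
move=> gm gg'; have g'm : g' m = None by rewrite -gg'.
elim=> [|n IHn] i lei; first exact: gg'.
rewrite !iterS; move: lei; rewrite leq_eqVlt => /predU1P[->|].
  by rewrite !half_step_wall ?iter_half_step_wall.
case: i => [|i] lim; first by rewrite /= IHn.
by rewrite /= !IHn // ltnW // ltnW.
Qed.

Lemma cylinderP (u : seq Q) x c : cylinder u x c <->
  forall i, i < size u -> c (x + i%:Z)%R = nth None u i.
Proof.
rewrite /cylinder; split=> [<- i|H].
  by rewrite size_map size_iota => li; rewrite (nth_map 0) ?size_iota // nth_iota.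
apply: (@eq_from_nth _ None); rewrite size_map size_iota // => i li.
by rewrite (nth_map 0) ?size_iota // nth_iota // H.
Qed.

Lemma size_init_word l t : size (init_word main l t) = l.+1.
Proof. by rewrite /= size_map size_iota. Qed.

Lemma nth_init_word l t i : i < l ->
  nth None (init_word main l t) i.+1 = mk_cell (t i) (head_mark main [:: main] 0 i).
Proof. by move=> li; rewrite /= (nth_map 0) ?size_iota // nth_iota. Qed.

Lemma segment_init_word g N l t : l <= N -> segment g N ([:: main], 0, t) ->
  forall i, i <= l -> g i = nth None (init_word main l t) i.
Proof.
move=> lN [g0 _ gi] [|i] li //.
by rewrite nth_init_word // gi // (leq_trans li).
Qed.

(** One fixed segment in the initial state has positive probability and shows the word at every
    multiple of [n]. *)
Lemma persistent_of_period n l t : 0 < n ->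
  miter main n ([:: main], 0, t) = Some ([:: main], 0, t) ->
  persistent ca_rule (init_word main l t).
Proof.
(* [n < N] keeps the head off the right wall for a period, and [l <= N] makes the word fit. *)
move=> n0 per to0; pose N := (n + l).+1; pose u := init_word main l t.
pose g0 i : Q := if i is i'.+1 then
  if i' < N then mk_cell (t i') (head_mark main [:: main] 0 i') else None else None.
have g0S g : (forall i, i < N.+2 -> g i = g0 i) -> segment g N ([:: main], 0, t).
  move=> gE; split; first by rewrite gE.
    by rewrite gE //= ltnn.
  by move=> i liN; rewrite gE ?ltnS ?(ltnW liN) //= liN.
have q0 : 0 < #|Q| by rewrite card_option.
have [|B HB] := to0 ((#|Q| ^ N.+2)%:R^-1)%R.
  by rewrite invr_gt0 ltr0n expn_gt0 q0.
(* A multiple of the period beyond [B], large enough for the segment to lie in the window that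
   starts at [- k]. *)
pose k := (B + N.+2) * n.
have [lBk lNk] : B <= k /\ N.+2 <= k.
  by split; apply: leq_trans (leq_pmulr _ n0); rewrite ?leq_addr ?leq_addl.
have := HB _ lBk; rewrite /pushforward_cyl /unif_measure_win -/u muln1.
set M := _ + 2 * k; set S := [set _ | _].
have szu : size u = l.+1 by apply: size_init_word.
have kM : k + N.+2 <= M by rewrite /M szu; lia.
have := card_window (Q := Q) (P := fun i => pred1 (g0 (i - k))) kM (fun i _ => card1 _).
set A := [set W | _]; rewrite exp1n mul1n => cardA.
have AS : A \subset S.
  apply/subsetP => W; rewrite !inE => /forallP WA; apply/asboolP => c /cylinderP cW.
  have cE i : i < N.+2 -> c (Posz i) = g0 i.
    move=> li; have lM : k + i < M by apply: leq_trans kM; rewrite ltn_add2l.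
    have := implyP (WA (Ordinal lM)); rewrite /= leq_addr ltn_add2l => /(_ li) /eqP.
    rewrite addKn (tnth_nth None) /= => <-; rewrite -cW ?size_tuple //.
    by congr c; lia.
  have gS := segment_period (g0S (fun i => c (Posz i)) cE) _ per (B + N.+2).
  apply/cylinderP => i; rewrite szu => li; rewrite add0r iter_ca_half ?cE //.
  apply: segment_init_word (gS _) _ _; rewrite /N; lia.
apply/negP; rewrite -leNgt ger0_norm ?divr_ge0 ?ler0n //.
rewrite ler_pdivlMr ?ltr0n ?expn_gt0 ?q0 // mulrC ler_pdivrMr ?ltr0n ?expn_gt0 ?q0 //.
by rewrite -natrM ler_nat -cardA leq_mul2r subset_leq_card ?orbT.
Qed.

(** At late times the word can occur only if cells [1] to [N0] initially contain no wall, and this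
    has probability [(s / #|Q|) ^ N0] with [s] the number of other states. *)
Lemma not_persistent_of_fail l t : 1 < l ->
  (forall t' : tape track, (forall i, i < l -> t' i = t i) ->
     exists n, miter main n ([:: main], 0, t') = None) ->
  ~ persistent ca_rule (init_word main l t).
Proof.
move=> l1 fail; apply=> eps eps0.
pose u := init_word main l t; pose s := #|{: option (symbol track * (bool + ctl main))}|.
have szu : size u = l.+1 by apply: size_init_word.
have cardQ : #|Q| = s.+1 by rewrite card_option.
have [N0 ltN0] := pow_ratio_lt s eps0.
(* Here [y] gives the initial cells [0] to [N0], with a wall after cell [0]. If the word ever
   occurs, the error reaches cell [1] later and stays there; otherwise [B = 0] works. *)
have ev (y : N0.+1.-tuple Q) : exists B, forall n, B <= n -> forall c : config Q,
    (forall i, i <= N0 -> c (Posz i) = nth None y i) ->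
    (exists2 i, 0 < i <= N0 & nth None y i = None) ->
    ~ cylinder u 0 (iter n F c).
  have [[n0 [c0 [c0y [i0 /andP[i0_gt0 li0] yi0] cyl0]]]|none] := pselect
    (exists n c, [/\ forall i, i <= N0 -> c (Posz i) = nth None y i,
       exists2 i, 0 < i <= N0 & nth None y i = None & cylinder u 0 (iter n F c)]);
    last first.
    by exists 0 => n _ c cy yi cyl; apply: none; exists n, c.
  move/cylinderP: cyl0; rewrite szu => cyl0.
  (* Walls are never created, so the one seen at time [n0] is initial. *)
  have c00 : c0 0%R = None.
    apply/eqP/contraT => /(iter_ca_cell n0) /eqP; have := cyl0 0 isT.
    by rewrite addr0 => ->.
  pose g0 := iter n0 (@half_step _ main) (fun j => c0 (Posz j)).
  have ex : exists m, (m < N0) && (c0 (Posz m.+1) == None).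
    by exists i0.-1; rewrite prednK // li0 c0y // yi0.
  have [m /andP[mN0 /eqP c0m] m_min] := ex_minnP ex.
  have [||i lim|t0 Ht0] := @init_prefix_err _ main g0 m l t l1 _ _ _ fail.
  - apply: (@eq_from_nth _ None); rewrite size_map size_iota ?size_init_word // => i li.
    by rewrite (nth_map 0) ?size_iota // nth_iota // /g0 -iter_ca_half // -cyl0 // add0r.
  - exact: iter_half_step_wall.
  - apply: iter_half_step_cell; apply/negP => /eqP ci.
    by have := m_min i; rewrite ci eqxx (ltn_trans lim) // leqNgt lim => /(_ isT).
  exists (t0 + n0) => n /subnK en c cy _ /cylinderP; rewrite szu => /(_ 1).
  rewrite ltnS (ltnW l1) add0r iter_ca_half => [/(_ isT)|]; last by rewrite cy // -c0y.
  rewrite (@half_step_local _ (fun j => c0 (Posz j)) m.+1) //; last first.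
  - by move=> i lei; rewrite cy ?c0y // (leq_trans lei).
  - by rewrite cy ?c0y // -c0y.
  rewrite -en addnA iterD Ht0 ?leq_addl //.
  by rewrite nth_init_word // ltnW.
have [Bf HBf] := choice ev.
(* The bound is uniform since there are finitely many [y]; [N0 <= n] puts cells [1] to [N0] inside
   the window. *)
exists (maxn (\max_y Bf y) N0) => n; rewrite geq_max => /andP[lBn lN0n].
rewrite /pushforward_cyl /unif_measure_win -/u muln1.
set M := _ + 2 * n; set S := [set _ | _].
have kM : n.+1 + N0 <= M by rewrite /M szu; lia.
have Ps i : n.+1 <= i < n.+1 + N0 -> #|predC1 (None : Q)| = s.
  by move=> _; rewrite cardC1 cardQ.
have := card_window (Q := Q) (P := fun i => predC1 None) kM Ps.
set A := [set W | _] => cardA.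
have SA : S \subset A.
  apply/subsetP => W; rewrite !inE => /asboolP WS; apply/forallP => i; apply/implyP => ni.
  apply/negP => /eqP Wi.
  pose c : config Q := fun x => nth None W `|(x + Posz n)%R|%N.
  pose y : N0.+1.-tuple Q := [tuple c (Posz j) | j < N0.+1].
  have yE j : j <= N0 -> c (Posz j) = nth None y j.
    by move=> lj; have := tnth_nth None y (Ordinal (lj : j < N0.+1)); rewrite tnth_mktuple.
  apply: (HBf y n _ c yE _ (WS c _)).
  - by apply: leq_trans lBn; apply: leq_bigmax.
  - exists (i - n); first by lia.
    rewrite -yE /c; last by lia.
    rewrite (tnth_nth None) in Wi; apply: etrans Wi; congr nth.
    by rewrite -PoszD subnK //; case/andP: ni => /ltnW.
  - apply/cylinderP => j _; rewrite /c; congr nth; lia.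
rewrite ger0_norm ?divr_ge0 ?ler0n //; apply: le_lt_trans ltN0.
rewrite ler_pdivrMr ?ltr0n ?expn_gt0 ?cardQ // mulrAC ler_pdivlMr ?ltr0n ?expn_gt0 //.
by rewrite -!natrM ler_nat -cardQ -cardA leq_mul2r subset_leq_card ?orbT.
Qed.
End Persistence.

(** * Diagonalization *)

Definition counter_word n := init_word interp n.+1 (tape0 n).

Definition rank (q : cell interp) : nat := enum_rank q.
(** For [n > 0], the tape [tape0 n] has its mark of [rN] at [n] and all its other marks at [0], so
    three symbols occur on it. *)
Definition symbol_first : symbol (option 'I_11) := [ffun j => j != Some rN].
Definition symbol_mid : symbol (option 'I_11) := [ffun=> false].
Definition symbol_last : symbol (option 'I_11) := [ffun j => j == Some rN].

Lemma code_counter_word n : 0 < n -> code_word (counter_word n) =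
  code [:: rank None, rank (mk_cell symbol_first (inr (to_ctl interp [:: interp])))
    & nseq n.-1 (rank (mk_cell symbol_mid (inl false)))
      ++ [:: rank (mk_cell symbol_last (inl false))]].
Proof.
have reg0 (r : 'I_11) (k : nat) : regs k 0 0 0 0 0 r = if r == rN then k else 0.
  rewrite /regs -val_eqE /=; case: r => i Hi /=; do 11 (destruct i as [|i]; first by []).
  by [].
case: n => // n _; have iotaE : iota 0 n.+2 = 0 :: iota 1 n ++ [:: n.+1].
  by rewrite -[n.+2]addn1 iotaD.
rewrite /code_word /counter_word /init_word iotaE; congr (code _).
rewrite !map_cons !map_cat [_.-1]/=; congr [:: _, _ & _].
  congr (nat_of_ord (enum_rank (mk_cell _ _))); apply/ffunP => -[r|]; rewrite !ffunE //.
  by rewrite reg0 (inj_eq (@Some_inj _)); case: (r == rN).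
congr (_ ++ [:: _]).
  rewrite -map_comp; have : all (fun i => 0 < i <= n) (iota 1 n).
    by apply/allP => i; rewrite mem_iota add1n ltnS.
  rewrite -[n in RHS](size_iota 1); elim: (iota 1 n) => //= i l IHl /andP[/andP[i0 lin] /IHl->].
  congr (_ :: _); rewrite /rank; congr (nat_of_ord (enum_rank (mk_cell _ _))).
    apply/ffunP => -[r|]; rewrite !ffunE; last by rewrite gtn_eqF.
    by rewrite reg0; case: ifP => _; [rewrite ltn_eqF // ltnS | rewrite gtn_eqF].
  by rewrite /head_mark gtn_eqF.
congr (nat_of_ord (enum_rank (mk_cell _ _))); apply/ffunP => -[r|]; rewrite !ffunE //.
by rewrite reg0 (inj_eq (@Some_inj _)); case: (r == rN); rewrite ?eqxx.
Qed.

Theorem mainTheorem6 :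
  exists (Q : finType) (r : nat) (delta : {ffun 'I_(2 * r + 1) -> Q} -> Q),
    ~ recursive_lang (persistent delta).
Proof.
exists (cell interp), 1, (@ca_rule _ interp) => -[f Hf].
(* On input [n] this computes the code of [counter_word n], makes it a one-element argument list and
   applies [f]. The letters are constants, so taking [n := code l] is not circular. *)
pose l := word_prog (rank None) (rank (mk_cell symbol_first (inr (to_ctl interp [:: interp]))))
    (rank (mk_cell symbol_mid (inl false))) (rank (mk_cell symbol_last (inl false)))
  ++ pair_prog [::] [:: 0] ++ compile f.
pose n := code l.
have n_gt0 : 0 < n by rewrite /n -[l]/(5 :: behead l) code_cons cons_code_gt0.
have run y : reval f [:: code_word (counter_word n)] y -> istar n 0 n 0 0 0 y 0.
  move=> /(compile_correct (f := f)) Hy.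
  suff Hl : computes l n y by exact: (Hl 0 0 0).
  apply: computes_cat (computes_word _ _ _ _ _) _; rewrite -code_counter_word //.
  apply: computes_cat Hy.
  exact: computes_pair (@computes_nil _) (@computes_zero _).
(* Answer [1] makes the head fall off, so the word is not persistent; answer [0] makes the machine
   periodic, so it is. *)
case: (Hf (counter_word n)) => -[pers /run st].
  exact: not_persistent_of_fail (interp_fail st isT) pers.
have [m m0 per] := interp_period st.
by apply: pers; apply: persistent_of_period m0 per.
Qed.
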